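(* Let $n,m\ge 1$, let $P_1,\dots,P_m\in\mathbb{Z}[x_1,\dots,x_n]$, let $d=\max_{1\le j\le m}\deg P_j$, and let $$\Gamma=\{(\mathbf{x},\mathbf{y})\in\mathbb{R}^n\times\mathbb{R}^m : y_1=P_1(\mathbf{x}),\dots,y_m=P_m(\mathbf{x})\}.$$ Write $P_i=P_{i,0}+\dots+P_{i,d}$, where $P_{i,k}$ is homogeneous of degree $k$ (possibly zero), and suppose that the only common zero of $P_{1,d},\dots,P_{m,d}$ in $\overline{\mathbb{Q}}^{\,n}$ is $0$. Then for every $\tau>\frac{n+1}{nd}$ the Hausdorff dimension of $\mathcal{I}_\tau(\Gamma)$ is $$\dim\mathcal{I}_\tau(\Gamma)=\frac{1+n}{d\tau}.$$ Furthermore, if $\tau>d$, then also $\mathcal{S}_\tau(\Gamma)=\mathcal{I}_\tau(\Gamma)$.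
   Context: $\|\cdot\|_\infty$ is the sup-norm and $\mathbb{N}=\{1,2,\dots\}$. For $M\subseteq\mathbb{R}^k$ and $\tau>0$, $\mathcal{S}_\tau(M)$ is the set of $\mathbf{x}\in M$ for which there are infinitely many rational points $\mathbf{p}/q$ ($\mathbf{p}\in\mathbb{Z}^k$, $q\in\mathbb{N}$) with $\|\mathbf{x}-\mathbf{p}/q\|_\infty\le q^{-\tau}$. $\mathcal{I}_\tau(M)$ is the set of $\mathbf{x}\in M$ for which there are infinitely many rational points $\mathbf{p}/q\in\mathbb{Q}^k\cap M$ ($\mathbf{p}\in\mathbb{Z}^k$, $q\in\mathbb{N}$) with $\|\mathbf{x}-\mathbf{p}/q\|_\infty\le q^{-\tau}$. For $\Gamma$ above, $k=n+m$. *)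

(* Defs.v *)
From mathcomp Require Export all_boot all_order all_algebra all_field.
(* mpoly's reserved notations clash with those of MathComp-Analysis. *)
From mathcomp Require Export -(notations) mpoly.
From mathcomp Require Export all_classical all_reals all_analysis.
Export numFieldNormedType.Exports.

Set Implicit Arguments.
Unset Strict Implicit.
Unset Printing Implicit Defensive.

Import Order.TTheory GRing.Theory Num.Theory.

Local Open Scope classical_set_scope.
Local Open Scope ring_scope.

Section Hausdorff.
Context {R : realType} {T : normedModType R}.
Local Open Scope ereal_scope.

(* The value 0 is included so that the diameter of set0 is 0 and not -oo. *)
Definition diam (U : set T) : \bar R :=
  ereal_sup [set e | e = 0 \/
    exists x y, [/\ U x, U y & e = (`|x - y|%R)%:E]].

(* As 0 `^ 0 = 1 in the library, the case distinction only matters for s = 0,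
   where it makes the 0-dimensional measure the counting measure. *)
Definition diam_pow (s : R) (U : set T) : \bar R :=
  if U == set0 then 0 else poweR (diam U) s.

Definition hausdorff_content (s delta : R) (A : set T) : \bar R :=
  ereal_inf [set e | exists U : (set T)^nat,
    [/\ A `<=` \bigcup_i U i,
        forall i, diam (U i) <= delta%:E &
        e = \sum_(0 <= i <oo) diam_pow s (U i)]].

Definition hausdorff_measure (s : R) (A : set T) : \bar R :=
  ereal_sup [set hausdorff_content s delta A | delta in [set x : R | (0 < x)%R]].

Definition hausdorff_dim (A : set T) : \bar R :=
  ereal_inf [set s%:E | s in [set s : R | (0 <= s)%R /\ hausdorff_measure s A = 0]].

End Hausdorff.

Section Polynomials.
Variable n : nat.
Implicit Types p : mpoly n int.

(* Total degree, with the convention that the zero polynomial has degree 0. *)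
Definition tdeg p : nat := (mmeasure mdeg p).-1.

Definition homog_part (k : nat) p : mpoly n int :=
  \sum_(u <- msupp p | mdeg u == k) mcoeff u p *: mpolyX int u.

Definition zeval (K : comNzRingType) (v : 'rV[K]_n) p : K :=
  mmap intr (v 0) p.

Lemma homog_part_homog k p : homog_part k p \is ishomog1 k mdeg.
Proof.
rewrite /homog_part; apply: rpred_sum => u uk; apply: rpredZ.
by rewrite dhomogX.
Qed.

Lemma sum_homog_part p d : (tdeg p <= d)%N ->
  p = \sum_(0 <= k < d.+1) homog_part k p.
Proof.
move=> pd; rewrite [LHS]mpolyE /homog_part.
rewrite (exchange_big_dep xpredT) //= big_seq [RHS]big_seq.
apply: eq_bigr => u up; rewrite big_mkord.
have ud : (mdeg u < d.+1)%N.
  have := msize_mdeg_lt up; rewrite /tdeg in pd.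
  move=> h; apply: (leq_trans h); apply: (leq_trans (leqSpred _)).
  by rewrite ltnS.
by rewrite (big_pred1 (Ordinal ud)).
Qed.

End Polynomials.

Section Approximation.
Variable R : realType.

Definition ratpoint k (p : 'rV[int]_k) (q : nat) : 'rV[R]_k :=
  \row_i ((p 0 i)%:~R / q%:R).

(* Rational points are counted as points of R^k: different representations
   p/q of the same point count only once.  The norm on row vectors is the
   sup-norm. *)
Definition approximants k (tau : R) (x : 'rV[R]_k) : set 'rV[R]_k :=
  [set r | exists (p : 'rV[int]_k) (q : nat),
    [/\ (0 < q)%N, r = ratpoint p q & `|x - r| <= powR q%:R (- tau)]].

Definition simult_approx k (tau : R) (M : set 'rV[R]_k) : set 'rV[R]_k :=
  [set x | M x /\ infinite_set (approximants tau x)].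

Definition intrinsic_approx k (tau : R) (M : set 'rV[R]_k) : set 'rV[R]_k :=
  [set x | M x /\ infinite_set (approximants tau x `&` M)].

(* R^n x R^m is identified with R^(n+m), with x the first n coordinates. *)
Definition poly_graph n m (P : 'I_m -> mpoly n int) : set 'rV[R]_(n + m) :=
  [set v | forall j : 'I_m, rsubmx v 0 j = zeval (lsubmx v) (P j)].

End Approximation.

(* Main.v *)
(* A rational point of the graph lies over some a/b in lowest terms, and its
   denominator is comparable to b^d: by the Nullstellensatz some D x_i^N lies in
   the ideal of the P_{j,d} over Z for every i, so the part of b^d cancelled by
   the numerators b^d P_j(a/b) divides a constant.  Hence I_tau(Gamma) is, up to
   constants and a locally bi-Lipschitz map, the set of x in R^n with
   |x - a/b| <= b^(- d tau) for infinitely many a/b, and its dimension is given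
   by the Jarnik-Besicovitch theorem.
   The upper bound is the natural cover.  For the lower bound, a cover by sets
   U_i of sizes d_i with sum of d_i^s small is avoided by nested cubes: Dirichlet's
   theorem places a subcube close to a rational point of large denominator near
   half of the points of a fine grid, and averaging the weight of the U_i over
   these subcubes finds one on which the weight is again small relative to its
   size.
   When tau > d, a rational point p/q too close to the graph has
   q^d (P_j(p'/q) - p_j/q) an integer of absolute value < 1, hence zero. *)

Require Import Defs.
From mathcomp Require Import zify ring lra.

Set Implicit Arguments.
Unset Strict Implicit.
Unset Printing Implicit Defensive.

Import Order.TTheory GRing.Theory Num.Theory.

Local Open Scope classical_set_scope.
Local Open Scope ring_scope.

(** * Nullstellensatz over the integers *)

(** The hypothesis on common zeros concerns [algC], but its use is arithmetic, so the
    Nullstellensatz has to keep integer coefficients. It is therefore proved by adjoining one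
    variable at a time to the integers, for primes that contain no nonzero integer; the constant [D]
    is the price of passing to characteristic 0. For the lower bound no measure is built: the usual
    Cantor set with its mass distribution is replaced by a construction against one given cover. The
    condition kept along the nested cubes, that the sets meeting a cube of side [r] weigh at most
    [(r / 44) ^ s], has the same form at every scale. It does two things: it leaves few large sets
    in the next grid, and in the limit it excludes every set of the cover. With [sigma = d * tau],
    the lower bound on [tau] reads [n * sigma > n + 1]; it makes the subcubes finer than the grid
    and puts every [s < (n + 1) / sigma] below [n], as the count of large sets requires. *)

Section Ideals.
Variable A : comNzRingType.
Implicit Types (I : set A) (a b x y g : A).

Definition ideal I :=
  [/\ I 0, forall x y, I x -> I y -> I (x + y) & forall a x, I x -> I (a * x)].

(** The last clause makes the ideal proper and excludes quotients of positive characteristic, which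
    have no homomorphism to [algC]. *)
Definition char0_prime I :=
  [/\ ideal I, forall x y, I (x * y) -> I x \/ I y &
      forall k : int, I k%:~R -> k = 0].

Lemma idealB I x y : ideal I -> I x -> I y -> I (x - y).
Proof.
move=> [_ ID IM] Ix Iy; apply: ID => //.
by rewrite -mulN1r; apply: IM.
Qed.

Lemma ideal_sum I (K : finType) (P : pred K) (F : K -> A) :
  ideal I -> (forall k, P k -> I (F k)) -> I (\sum_(k | P k) F k).
Proof. by move=> [I0 ID IM] IF; apply: big_ind. Qed.

Lemma prime_idealX I x k : char0_prime I -> I (x ^+ k) -> I x.
Proof.
move=> [[I0 ID IM] Ip Ic]; elim: k => [|k IHk].
  by rewrite expr0 => I1; move: (Ic 1); rewrite mulr1z => /(_ I1).
by rewrite exprS => /Ip [].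
Qed.

Definition adjoin_ideal I g : set A := [set x | exists p u, I p /\ x = p + u * g].

Lemma adjoin_ideal_ideal I g : ideal I -> ideal (adjoin_ideal I g).
Proof.
move=> [I0 ID IM]; split.
- by exists 0, 0; rewrite mul0r addr0.
- move=> _ _ [p [u [Ip ->]]] [q [v [Iq ->]]].
  by exists (p + q), (u + v); split; [exact: ID|rewrite mulrDl addrACA].
- move=> a _ [p [u [Ip ->]]].
  by exists (a * p), (a * u); split; [exact: IM|rewrite mulrDr mulrA].
Qed.

Lemma sub_adjoin_ideal I g : I `<=` adjoin_ideal I g.
Proof. by move=> x Ix; exists x, 0; rewrite mul0r addr0. Qed.

Lemma mem_adjoin_ideal I g : ideal I -> adjoin_ideal I g g.
Proof. by move=> [I0 _ _]; exists 0, 1; rewrite mul1r add0r. Qed.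

(* A maximal ideal among those missing the multiplicative set of all
   [k * g ^+ N] is prime. *)
Lemma char0_prime_exists I g : ideal I ->
  (forall (k : int) N, I (k%:~R * g ^+ N) -> k = 0) ->
  exists p, [/\ char0_prime p, I `<=` p & ~ p g].
Proof.
move=> idI Ig.
pose good J := [/\ ideal J, I `<=` J &
  forall (k : int) N, J (k%:~R * g ^+ N) -> k = 0].
have goodI : good I by split.
(* The alternative [J = set0] serves chains with empty union, such as the empty chain; a maximal [p]
   is not of this kind, since [I] is good. *)
have [F FP Ftot|p [pP pmax]] := @Zorn_bigcup A (fun J => J = set0 \/ good J).
  have [[J [FJ J0]]|F0] := pselect (exists J, F J /\ J !=set0); last first.
    left; apply/seteqP; split => // x [J FJ Jx]; apply: F0.
    by exists J; split => //; exists x.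
  have goodF K : F K -> K !=set0 -> good K.
    by move=> FK [x Kx]; case: (FP K FK) => // K0; rewrite K0 in Kx.
  have gJ := goodF _ FJ J0.
  right; split.
  - split.
    + by exists J => //; case: gJ => -[].
    + move=> x y [K FK Kx] [L FL Ly].
      have gK := goodF _ FK (ex_intro _ x Kx).
      have gL := goodF _ FL (ex_intro _ y Ly).
      case: (Ftot K L FK FL) => KL.
        by exists L => //; case: gL => -[_ + _ _ _]; apply => //; exact: KL.
      by exists K => //; case: gK => -[_ + _ _ _]; apply => //; exact: KL.
    + move=> a x [K FK Kx]; exists K => //.
      by have [[_ _ +] _ _] := goodF _ FK (ex_intro _ x Kx); apply.
  - by move=> x Ix; exists J => //; case: gJ => _ + _; apply.
  - move=> k N [K FK Kx].
    by have [_ _ +] := goodF _ FK (ex_intro _ _ Kx); apply; exact: Kx.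
have gp : good p.
  case: pP => // p0; exfalso; apply: (pmax I); last by right.
  rewrite p0; split => // h; case: idI => I0 _ _; exact: (h 0 I0).
have [idp Ip pg] := gp; have [p0 pD pM] := idp.
have adj x : ~ p x -> exists (k : int) N, k <> 0 /\ adjoin_ideal p x (k%:~R * g ^+ N).
  move=> px; apply: contrapT => h; apply: (pmax (adjoin_ideal p x)).
    split; first exact: sub_adjoin_ideal.
    by move=> /(_ x (mem_adjoin_ideal x idp)).
  right; split; first exact: adjoin_ideal_ideal.
    by apply: subset_trans Ip _; exact: sub_adjoin_ideal.
  move=> k N kN; apply: contrapT => k0; apply: h.
  by exists k, N.
exists p; split => //; last first.
  by move=> pgg; have := pg 1 1%N; rewrite mul1r expr1 => /(_ pgg).
split => //; last first.
  by move=> k pk; apply: (pg k 0%N); rewrite expr0 mulr1.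
move=> x y pxy; apply: contrapT => /not_orP [px py].
have [k [N [k0 [r [u [pr e]]]]]] := adj x px.
have [l [M [l0 [s [v [ps e']]]]]] := adj y py.
have : p ((k * l)%:~R * g ^+ (N + M)).
  rewrite intrM exprD mulrACA e e' mulrDl; apply: (pD).
    by rewrite mulrC; apply: pM.
  rewrite mulrDr; apply: pD; first exact: pM.
  by rewrite mulrACA; apply: pM.
move=> /pg /eqP; rewrite mulf_eq0 => /orP [] /eqP //.
Qed.

End Ideals.

(** Homomorphisms killing [I] are the algebraic points of its variety. Stated for a ring [A], the
    property can be passed on from [A] to [{poly A}]. *)
Definition nullstellensatz (A : comNzRingType) := forall (I : set A) (g : A),
  char0_prime I -> ~ I g ->
  exists phi : {rmorphism A -> algC}, (forall x, I x -> phi x = 0) /\ phi g <> 0.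

Lemma nullstellensatz_int : nullstellensatz int.
Proof.
move=> I g [[I0 _ _] _ Ic] Ig; exists intr; split.
  by move=> x; rewrite -[x]intz => /Ic ->.
by move=> /eqP; rewrite intr_eq0 => /eqP g0; apply: Ig; rewrite g0.
Qed.

Section PolyStep.
Variables (A : comNzRingType) (I : set {poly A}).
Hypothesis primeI : char0_prime I.
(** [Q] is the contraction of [I], and [good p] means that reduction modulo [Q] keeps the degree of
    [p]. Together they imitate division over the fraction field of [A / Q] without leaving
    [{poly A}]. *)
Let Q : set A := [set a | I a%:P].
Let good (p : {poly A}) := ~ Q (lead_coef p).

Let idI : ideal I. Proof. by case: primeI. Qed.

Let primeQ : char0_prime Q.
Proof.
case: primeI => -[I0 ID IM] Ip Ic; split.
- split; rewrite /Q /=; first by rewrite polyC0.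
    by move=> x y ? ?; rewrite polyCD; apply: ID.
  by move=> x y ?; rewrite polyCM; apply: IM.
- by move=> x y; rewrite /Q /= polyCM => /Ip.
- by move=> k; rewrite /Q /= rmorph_int => /Ic.
Qed.

Let Q0 : Q 0. Proof. by case: primeQ => -[]. Qed.

Lemma poly_coef_ideal (p : {poly A}) : (forall k, Q p`_k) -> I p.
Proof.
move=> Qp; rewrite -[p]coefK poly_def; apply: ideal_sum => // k _.
rewrite -mul_polyC mulrC; case: idI => _ _; apply; exact: Qp.
Qed.

Lemma truncate_modulo (p : {poly A}) : ~ (forall k, Q p`_k) ->
  exists p', [/\ good p', (size p' <= size p)%N & forall k, Q (p - p')`_k].
Proof.
move=> /existsNP [k0 Qk0].
pose P k := `[< ~ Q p`_k >].
have exP : exists k, P k by exists k0; apply/asboolP.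
have ub k : P k -> (k <= size p)%N.
  move=> /asboolP; rewrite leqNgt => h; apply/negP => ltk; apply: h.
  by rewrite nth_default // ltnW.
case: (ex_maxnP exP ub) => k /asboolP Qk kmax.
have pk0 : p`_k != 0 by apply/eqP => e; apply: Qk; rewrite e.
exists (\poly_(i < k.+1) p`_i); split.
- by rewrite /good lead_coef_poly.
- rewrite size_poly_eq //; rewrite ltnNge; apply/negP => h.
  by rewrite nth_default ?eqxx in pk0.
- move=> j; rewrite coefB coef_poly; case: ltnP => [_|kj].
    by rewrite subrr.
  rewrite subr0; apply: contrapT => /asboolP /kmax.
  by rewrite leqNgt kj.
Qed.

Lemma good_min (J : set {poly A}) : (exists p, J p /\ good p) ->
  exists w, [/\ J w, good w & forall p, J p -> good p -> (size w <= size p)%N].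
Proof.
move=> [p [Jp gp]].
pose P k := `[< exists p, [/\ J p, good p & size p = k] >].
have exP : exists k, P k by exists (size p); apply/asboolP; exists p.
case: (ex_minnP exP) => k /asboolP [w [Jw gw sw]] kmin.
exists w; split => // r Jr gr; rewrite sw; apply: kmin.
by apply/asboolP; exists r.
Qed.

(** Pseudo-division leaves a remainder in [J] of smaller size than [w]; were it nonzero modulo [Q],
    its truncation would be a good element contradicting the minimality of [w]. *)
Lemma good_min_mod (J : set {poly A}) w h : ideal J -> I `<=` J ->
  J w -> good w -> (forall p, J p -> good p -> (size w <= size p)%N) -> J h ->
  exists k q r, [/\ lead_coef w ^+ k *: h = q * w + r & forall j, Q r`_j].
Proof.
move=> idJ IJ Jw gw minw Jh.
exists (Pdiv.Ring.rscalp h w), (Pdiv.Ring.rdivp h w), (Pdiv.Ring.rmodp h w).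
have e := Pdiv.ComRing.rdivp_eq w h; split=> //.
apply: contrapT => Qr.
have [r' [gr' sr' Qr']] := truncate_modulo Qr.
have w0 : w != 0 by apply/eqP => w0; apply: gw; rewrite w0 lead_coef0.
have Jr : J (Pdiv.Ring.rmodp h w).
  have -> : Pdiv.Ring.rmodp h w = lead_coef w ^+ Pdiv.Ring.rscalp h w *: h
      - Pdiv.Ring.rdivp h w * w by rewrite e addrC addKr.
  case: (idJ) => J0 JD JM; apply: idealB => //; last exact: JM.
  by rewrite -mul_polyC; apply: JM.
have Jr' : J r'.
  have -> : r' = Pdiv.Ring.rmodp h w - (Pdiv.Ring.rmodp h w - r') by ring.
  by apply: idealB => //; apply: IJ; exact: poly_coef_ideal.
have := minw _ Jr' gr'; rewrite leqNgt => /negP; apply.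
by apply: leq_ltn_trans sr' _; rewrite Pdiv.Ring.ltn_rmodp.
Qed.

(* With [f] of least degree in [I] modulo [Q], and [w] of least degree in
   [I + (g)] modulo [Q], pseudo-division shows that [w] is a constant; a point
   of [A] at which [w] and the leading coefficient of [f] do not vanish then
   extends to any root of [f]. *)
Lemma nullstellensatz_poly_step g : nullstellensatz A -> ~ I g ->
  exists phi : {rmorphism {poly A} -> algC},
    (forall x, I x -> phi x = 0) /\ phi g <> 0.
Proof.
move=> nsA Ig; have [I0 ID IM] := idI.
have Iprime x y : I (x * y) -> I x \/ I y by case: primeI => _ + _; apply.
have Qprime x y : Q (x * y) -> Q x \/ Q y by case: primeQ => _ + _; apply.
have Qphi (phi : {rmorphism A -> algC}) (c : algC) (r : {poly A}) :
    (forall x, Q x -> phi x = 0) -> (forall k, Q r`_k) -> (map_poly phi r).[c] = 0.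
  move=> phiQ Qr; suff -> : map_poly phi r = 0 by rewrite horner0.
  by apply/polyP => k; rewrite coef_map coef0 /= phiQ.
(* Without such an [f], all coefficients of elements of [I] lie in [Q]; any value of the variable at
   which the image of [g] is nonzero will do. *)
have [exf|nof] := pselect (exists f, I f /\ good f); last first.
  have [k Qk] : exists k, ~ Q g`_k.
    by apply/existsNP => h; apply: Ig; exact: poly_coef_ideal.
  have [phi [phiQ phig]] := nsA Q g`_k primeQ Qk.
  have gphi0 : map_poly phi g != 0.
    apply/eqP => /polyP /(_ k); rewrite coef_map coef0 => e; exact: phig.
  have [c rc] := closed_nonrootP _ gphi0.
  exists (horner_morph (fun x => mulrC c (phi x))); split; last first.
    by move=> e; move/negP: rc; apply; apply/rootP.
  move=> x Ix; apply: Qphi => //; apply: contrapT => Qx.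
  have [x' [gx' _ Qx']] := truncate_modulo Qx; apply: nof; exists x'; split=> //.
  have -> : x' = x - (x - x') by ring.
  by apply: idealB => //; exact: poly_coef_ideal.
have [f [If gf minf]] := good_min exf.
set J := adjoin_ideal I g.
have idJ : ideal J by exact: adjoin_ideal_ideal.
have IJ : I `<=` J by exact: sub_adjoin_ideal.
have [w [Jw gw minw]] : exists w, [/\ J w, good w &
    forall p, J p -> good p -> (size w <= size p)%N].
  by apply: good_min; exists f; split=> //; exact: IJ.
have QX a k : ~ Q a -> ~ Q (a ^+ k).
  by move=> Qa /(prime_idealX primeQ).
have Iscale a x : ~ Q a -> I (a *: x) -> I x.
  by move=> Qa; rewrite -mul_polyC => /Iprime [].
have wI : ~ I w.
  move=> Iw; have [k [q [r [e Qr]]]] := good_min_mod idJ IJ Jw gw minw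
    (mem_adjoin_ideal g idI).
  apply: Ig; apply: (Iscale (lead_coef w ^+ k)); first exact: QX.
  by rewrite e; apply: ID; [exact: IM|exact: poly_coef_ideal].
(* Modulo [Q], a multiple of [f] equals [q * w]. As [I] is prime and misses [w], it contains [q],
   which by minimality of [f] is no shorter than [f] modulo [Q]; this leaves degree 0 for [w]. *)
have sw : (size w <= 1)%N.
  have [k [q [r [e Qr]]]] := good_min_mod idJ IJ Jw gw minw (IJ _ If).
  have Iq : I q.
    have : I (q * w).
      have -> : q * w = lead_coef w ^+ k *: f - r by rewrite e addrK.
      apply: idealB => //; last exact: poly_coef_ideal.
      by rewrite -mul_polyC; apply: IM.
    by case/Iprime.
  have Qq : ~ (forall j, Q q`_j).
    move=> Qq; apply: (QX (lead_coef w) k gw); apply: contrapT => Qwk.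
    have : Q ((lead_coef w ^+ k *: f)`_(size f).-1).
      rewrite e coefD; case: primeQ => -[_ QD QM] _ _; apply: QD => //.
      rewrite coefM; apply: ideal_sum; first by case: primeQ.
      by move=> i _; rewrite mulrC; apply: QM.
    by rewrite coefZ => /Qprime [].
  have [q' [gq' sq' Qq']] := truncate_modulo Qq.
  have Iq' : I q'.
    have -> : q' = q - (q - q') by ring.
    by apply: idealB => //; exact: poly_coef_ideal.
  have sf := minf _ Iq' gq'.
  rewrite leqNgt; apply/negP => sw.
  have : ~ Q ((q' * w)`_(size q' + size w).-2).
    by rewrite -mul_lead_coef => /Qprime [].
  apply.
  have -> : q' * w = lead_coef w ^+ k *: f - r - (q - q') * w.
    by rewrite e; ring.
  rewrite !coefB coefZ [f`__]nth_default ?mulr0 ?sub0r; last first.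
    by apply: leq_trans sf _; move: (size q') (size w) sw => a b; lia.
  have idQ : ideal Q by case: primeQ.
  apply: idealB => //; first by rewrite -sub0r; apply: idealB.
  rewrite coefM; apply: ideal_sum => // i _; rewrite mulrC.
  by case: idQ => _ _; apply.
have [phi [phiQ phiab]] : exists phi : {rmorphism A -> algC},
    (forall x, Q x -> phi x = 0) /\ phi (lead_coef f * lead_coef w) <> 0.
  by apply: nsA => // /Qprime [].
have phia : phi (lead_coef f) != 0.
  by apply/eqP => e; apply: phiab; rewrite rmorphM e mul0r.
have phib : phi (lead_coef w) != 0.
  by apply/eqP => e; apply: phiab; rewrite rmorphM /= e mulr0.
have [c rc] : exists c, root (map_poly phi f) c.
  apply/closed_rootP; rewrite size_map_poly_id0 //.
  apply/eqP => sf1; apply: gf.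
  have [z z0 ef] := size_poly1P f (introT eqP sf1).
  by rewrite ef lead_coefC /Q /= -ef.
have phif : (map_poly phi f).[c] = 0 by apply/rootP.
pose psi : {rmorphism {poly A} -> algC} := horner_morph (fun x => mulrC c (phi x)).
have psiI x : I x -> psi x = 0.
  move=> Ix; have [k [q [r [e Qr]]]] := good_min_mod idI (@subset_refl _ I) If gf minf Ix.
  have : psi (lead_coef f ^+ k *: x) = 0.
    rewrite e rmorphD rmorphM /= /horner_morph phif mulr0 add0r.
    exact: Qphi.
  rewrite -mul_polyC rmorphM /= horner_morphC => /eqP.
  by rewrite rmorphXn mulf_eq0 expf_eq0 (negPf phia) andbF => /eqP.
exists psi; split=> // psig.
have [p [u [Ip ew]]] := Jw.
have : psi w = 0 by rewrite ew rmorphD rmorphM psig mulr0 addr0 psiI.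
rewrite (size1_polyC sw) /= horner_morphC => h; apply/negP: phib; apply/negPn/eqP.
by rewrite (size1_polyC sw) lead_coefC.
Qed.

End PolyStep.

Lemma nullstellensatz_poly (A : comNzRingType) :
  nullstellensatz A -> nullstellensatz {poly A}.
Proof. by move=> nsA I g pI Ig; exact: nullstellensatz_poly_step. Qed.

(** * Denominators of rational points on the graph *)

(** Integer polynomials in [n] variables, in the form to which the one-variable step applies by
    induction. *)
Fixpoint iter_poly (n : nat) : comNzRingType :=
  if n is k.+1 then {poly (iter_poly k)} else int.

Lemma nullstellensatz_iter n : nullstellensatz (iter_poly n).
Proof.
elim: n => [|n IHn]; first exact: nullstellensatz_int.
exact: nullstellensatz_poly.
Qed.

(** Sending the variables anywhere is the half of the universal property that transports identities
    to the integers and points to [algC]. *)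
Lemma iter_poly_vars n : exists X : 'I_n -> iter_poly n,
  forall (K : comNzRingType) (v : 'I_n -> K),
  exists phi : {rmorphism iter_poly n -> K}, forall i, phi (X i) = v i.
Proof.
elim: n => [|n [X IHn]].
  by exists (fun=> 0) => K v; exists intr => -[].
exists (fun i => if unlift ord0 i is Some j then (X j)%:P else 'X) => K v.
have [phi phiX] := IHn K (v \o lift ord0).
exists (horner_morph (fun x => mulrC (v ord0) (phi x))) => i.
case: unliftP => [j ->|->] /=; first by rewrite horner_morphC phiX.
by rewrite horner_morphX.
Qed.

Lemma rmorph_mmap n (A B : comNzRingType) (phi : {rmorphism A -> B})
    (h : 'I_n -> A) (f : mpoly n int) :
  phi (mmap intr h f) = mmap intr (phi \o h) f.
Proof.
rewrite /mmap rmorph_sum; apply: eq_bigr => u _.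
rewrite rmorphM rmorph_int /mmap1 rmorph_prod; congr (_ * _).
by apply: eq_bigr => i _; rewrite rmorphXn.
Qed.

Lemma eq_mmap n (A : comNzRingType) (h k : 'I_n -> A) (f : mpoly n int) :
  h =1 k -> mmap intr h f = mmap intr k f.
Proof.
move=> hk; rewrite /mmap; apply: eq_bigr => u _; congr (_ * _).
by apply: eq_bigr => i _; rewrite hk.
Qed.

(** A multiple [D * g ^ N] lies in the ideal of the [Q i]: otherwise a prime containing them but
    missing [g] would yield a common zero in [algC] where [g] does not vanish. Evaluation at [a]
    modulo an arbitrary [J] is the form in which congruences use it. *)
Lemma nullstellensatz_eval n m (Q : 'I_m -> mpoly n int) (g : mpoly n int) :
  (forall z : 'rV[algC]_n, (forall i, zeval z (Q i) = 0) -> zeval z g = 0) ->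
  exists (D : int) (N : nat), D <> 0 /\
    forall (a : 'rV[int]_n) (J : set int), ideal J ->
      (forall i, J (zeval a (Q i))) -> J (D * zeval a g ^+ N).
Proof.
move=> Qg; have [X Xeval] := iter_poly_vars n.
pose s : {rmorphism mpoly n int -> iter_poly n} := mmap intr X.
have sE (K : comNzRingType) (phi : {rmorphism iter_poly n -> K}) f :
    phi (s f) = zeval (\row_i phi (X i)) f.
  by rewrite /s rmorph_mmap /zeval; apply: eq_mmap => i; rewrite /= mxE.
pose I : set (iter_poly n) := [set f | exists c, f = \sum_i c i * s (Q i)].
have idI : ideal I.
  split.
  - by exists (fun=> 0); rewrite big1 // => i _; rewrite mul0r.
  - move=> _ _ [c ->] [e ->]; exists (fun i => c i + e i).
    by rewrite -big_split; apply: eq_bigr => i _; rewrite mulrDl.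
  - move=> a _ [c ->]; exists (fun i => a * c i).
    by rewrite mulr_sumr; apply: eq_bigr => i _; rewrite mulrA.
have [[D [N [D0 [c e]]]]|noD] :=
    pselect (exists (D : int) N, D <> 0 /\ I (D%:~R * s g ^+ N)).
  exists D, N; split=> // a J idJ JQ.
  have [phi phiX] := Xeval _ (a 0).
  have ev f : phi (s f) = zeval a f.
    rewrite sE; congr zeval; apply/rowP => i; by rewrite mxE phiX.
  have -> : D * zeval a g ^+ N = phi (D%:~R * s g ^+ N).
    by rewrite rmorphM rmorph_int rmorphXn /= ev intz.
  rewrite e rmorph_sum; apply: ideal_sum => // i _.
  by rewrite rmorphM /= ev; case: idJ => _ _; apply.
exfalso.
have [p [pp Ip pg]] : exists p, [/\ char0_prime p, I `<=` p & ~ p (s g)].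
  apply: char0_prime_exists => // k N kN; apply: contrapT => k0.
  by apply: noD; exists k, N.
have [phi [phip phig]] := nullstellensatz_iter pp pg.
apply: phig; rewrite sE; apply: Qg => i; rewrite -sE; apply/phip/Ip.
exists (fun j => (j == i)%:R); rewrite (bigD1 i) //= eqxx mul1r big1 ?addr0 //.
by move=> j /negPf ->; rewrite mul0r.
Qed.

Lemma gcdnX a b k : gcdn (a ^ k) (b ^ k) = (gcdn a b ^ k)%N.
Proof.
have [->|a0] := posnP a.
  by case: k => [|k]; rewrite ?expn0 // exp0n // !gcd0n.
have g0 : (0 < gcdn a b)%N by rewrite gcdn_gt0 a0.
have [a' ea] := dvdnP (dvdn_gcdl a b).
have [b' eb] := dvdnP (dvdn_gcdr a b).
have [g eg] : exists g, gcdn a b = g by exists (gcdn a b).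
rewrite eg in g0 ea eb *; rewrite {1}ea {1}eb !expnMn -muln_gcdl.
suff /eqP -> : coprime (a' ^ k) (b' ^ k) by rewrite mul1n.
apply/coprimeXl/coprimeXr; rewrite /coprime -(eqn_pmul2r g0) mul1n.
by rewrite muln_gcdl -ea -eb eg.
Qed.

(* [b ^ d * P (a / b)], as an integer. *)
Definition cleared n (d : nat) (P : mpoly n int) (a : 'rV[int]_n) (b : nat) : int :=
  \sum_(u <- msupp P) mcoeff u P * mmap1 (a 0) u * b%:Z ^+ (d - mdeg u).

Lemma tdeg_msupp n (P : mpoly n int) u : u \in msupp P -> (mdeg u <= tdeg P)%N.
Proof.
move=> uP; rewrite /tdeg -ltnS.
by apply: leq_trans (msize_mdeg_lt uP) (leqSpred _).
Qed.

Lemma zeval_ratpoint (R : realType) n d (P : mpoly n int) (a : 'rV[int]_n) b :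
  (tdeg P <= d)%N -> (0 < b)%N ->
  zeval (ratpoint R a b) P * b%:R ^+ d = (cleared d P a b)%:~R.
Proof.
move=> Pd b0; rewrite /zeval /mmap mulr_suml /cleared rmorph_sum /=.
rewrite big_seq [RHS]big_seq; apply: eq_bigr => u uP.
have ud : (mdeg u <= d)%N by apply: leq_trans Pd; exact: tdeg_msupp.
rewrite !rmorphM /= -!mulrA; congr (_ * _); rewrite rmorphXn /=.
have -> : mmap1 (ratpoint R a b 0) u = (mmap1 (a 0) u)%:~R / b%:R ^+ mdeg u.
  rewrite /mmap1 rmorph_prod mdegE -prodrXr -prodfV -big_split /=.
  by apply: eq_bigr => i _; rewrite mxE expr_div_n rmorphXn.
rewrite -{1}(subnK ud) exprD -mulrA; congr (_ * _).
rewrite [X in _ * X]mulrC mulKf //.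
by rewrite expf_eq0 pnatr_eq0; case: (b) b0 => // ?; rewrite andbF.
Qed.

(** Every monomial of degree below [d] retains a factor [b]. *)
Lemma cleared_homog n d (P : mpoly n int) (a : 'rV[int]_n) b :
  (tdeg P <= d)%N ->
  exists e, cleared d P a b = zeval a (homog_part d P) + b%:Z * e.
Proof.
move=> Pd.
exists (\sum_(u <- msupp P | mdeg u != d)
  mcoeff u P * mmap1 (a 0) u * b%:Z ^+ (d - mdeg u).-1).
rewrite /cleared (bigID (fun u => mdeg u == d)) /=; congr (_ + _).
  rewrite /homog_part /zeval raddf_sum /=; apply: eq_bigr => u /eqP ->.
  by rewrite subnn mulr1 mmapZ mmapX /= intz.
rewrite mulr_sumr big_seq_cond [RHS]big_seq_cond.
apply: eq_bigr => u /andP [uP ud].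
have {}ud : (mdeg u < d)%N.
  by rewrite ltn_neqAle ud; apply: leq_trans Pd; exact: tdeg_msupp.
have -> : (d - mdeg u = (d - mdeg u).-1.+1)%N by lia.
by rewrite exprS /=; ring.
Qed.

(** The divisibility says that [q * P j (a / b)] is an integer. After division by [gcdn (b ^ d) q],
    the cofactor [g] of [b ^ d] divides every [cleared d (P j) a b], and it remains to bound [g]. *)
Lemma denominator_bound n m d (P : 'I_m -> mpoly n int) :
  (forall j, (tdeg (P j) <= d)%N) ->
  (forall z : 'rV[algC]_n, (forall j, zeval z (homog_part d (P j)) = 0) -> z = 0) ->
  exists2 D : nat, (0 < D)%N & forall (a : 'rV[int]_n) (b q : nat),
    (0 < b)%N -> (0 < q)%N -> \big[gcdn/b]_(i < n) `|a 0%R i|%N = 1%N ->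
    (forall j, (b%:Z ^+ d %| q%:Z * cleared d (P j) a b)%Z) ->
    (b ^ d <= D * q)%N.
Proof.
move=> Pd P0.
have NS (i : 'I_n) := @nullstellensatz_eval n m (fun j => homog_part d (P j)) (mpolyX int (mnm1 i)).
have /choice [F FP] : forall i, exists DN : int * nat, DN.1 <> 0 /\
    forall (a : 'rV[int]_n) (J : set int), ideal J ->
      (forall j, J (zeval a (homog_part d (P j)))) -> J (DN.1 * a 0 i ^+ DN.2).
  move=> i; have [|D [N [D0 DN]]] := NS i.
    by move=> z /P0 ->; rewrite /zeval mmapX mmap1U mxE.
  exists (D, N); split=> //= a J idJ Ja; have := DN a J idJ Ja.
  by rewrite /zeval mmapX mmap1U.
pose D := (\prod_i `|(F i).1|%N)%N.
have D0 : (0 < D)%N.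
  by apply: prodn_gt0 => i; rewrite absz_gt0; apply/eqP; case: (FP i).
exists (D ^ d)%N; first by rewrite expn_gt0 D0.
move=> a b q b0 q0 ab1 hq.
have bd0 : (0 < b ^ d)%N by rewrite expn_gt0 b0.
pose c := gcdn (b ^ d) q.
have c0 : (0 < c)%N by rewrite gcdn_gt0 bd0.
have [g eg] := dvdnP (dvdn_gcdl (b ^ d) q).
have [q' eq'] := dvdnP (dvdn_gcdr (b ^ d) q).
rewrite -/c in eg eq'.
have gq' : coprime g q'.
  by rewrite /coprime -(eqn_pmul2r c0) mul1n muln_gcdl -eg -eq'.
have gbd : (g %| b ^ d)%N by rewrite eg dvdn_mulr.
have gF j : (g %| `|cleared d (P j) a b|)%N.
  have := hq j; rewrite -[(_ %| _)%Z]/(_ %| _)%N abszM abszX !absz_nat.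
  rewrite eg {1}eq' mulnAC dvdn_pmul2r // => h.
  by rewrite -(Gauss_dvdr _ gq').
(* The ideal generated by [g] and [b]: modulo [b] only the top forms survive in the cleared values,
   and [g] divides these values. *)
pose J : set int := [set w | exists e, (g%:Z %| w - b%:Z * e)%Z].
have idJ : ideal J.
  split.
  - by exists 0; rewrite mulr0 subr0 dvdz0.
  - move=> x y [e he] [f hf]; exists (e + f).
    by rewrite mulrDr opprD addrACA; apply: rpredD.
  - move=> u x [e he]; exists (u * e).
    by rewrite mulrCA -mulrBr; apply: dvdz_mull.
have JP j : J (zeval a (homog_part d (P j))).
  have [e he] := @cleared_homog n d (P j) a b (Pd j); exists (- e).
  by rewrite mulrN opprK -he; exact: gF.
have g0 : (0 < g)%N by move: bd0; rewrite eg muln_gt0 => /andP [].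
(* [E] holds for [b] and for all [a i] and is stable under gcd, so coprimality gives it at 1, where
   it bounds [g]. *)
pose E x := exists M, (g %| D ^ d * x ^ M)%N.
have Eb : E b by exists d; apply: dvdn_mull.
have Ea i : E `|a 0%R i|%N.
  have [_ /(_ a J idJ JP)] := FP i; set Di := (F i).1; set N := (F i).2.
  move=> [e he]; exists (N * d)%N.
  (* Since [g] divides [b ^ d], the [d]-th power turns a congruence modulo [g] and [b] into
     divisibility by [g] alone. *)
  have h : (g %| (`|Di| * `|a 0%R i| ^ N) ^ d)%N.
    suff : (g%:Z %| ((Di * a 0 i ^+ N) ^+ d)%R)%Z.
      by rewrite -[(_ %| _)%Z]/(_ %| _)%N abszX abszM abszX absz_nat.
    rewrite -(subrK ((b%:Z * e) ^+ d) ((Di * a 0 i ^+ N) ^+ d)).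
    apply: rpredD; first by rewrite subrXX; apply: dvdz_mulr.
    rewrite exprMn; apply: dvdz_mulr.
    by rewrite -[(_ %| _)%Z]/(_ %| _)%N abszX !absz_nat.
  apply: dvdn_trans h _; rewrite expnM -expnMn; apply: dvdn_exp2r.
  apply: dvdn_mul => //.
  by rewrite /D (bigD1 i) //= dvdn_mulr.
have EI x y : E x -> E y -> E (gcdn x y).
  move=> [M hM] [N hN]; exists (maxn M N).
  rewrite -gcdnX muln_gcdr dvdn_gcd; apply/andP; split.
    by apply: dvdn_trans hM _; rewrite dvdn_mul // dvdn_exp2l // leq_maxl.
  by apply: dvdn_trans hN _; rewrite dvdn_mul // dvdn_exp2l // leq_maxr.
have [M] : E 1%N by rewrite -ab1; apply: big_ind => // i _; exact: Ea.
rewrite exp1n muln1 => gD.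
have gD' : (g <= D ^ d)%N by apply: dvdn_leq => //; rewrite expn_gt0 D0.
by rewrite eg; apply: leq_mul => //; rewrite dvdn_leq // dvdn_gcdr.
Qed.

Lemma coprime_rep n (R : realType) (p : 'rV[int]_n) q : (0 < q)%N ->
  exists (a : 'rV[int]_n) (b : nat), [/\ (0 < b)%N,
    \big[gcdn/b]_(i < n) `|a 0%R i|%N = 1%N & ratpoint R p q = ratpoint R a b].
Proof.
move=> q0; pose G := \big[gcdn/q]_(i < n) `|p 0%R i|%N.
have Gq : (G %| q)%N.
  rewrite /G; apply: (big_rec (fun x => x %| q)%N) => // i x _.
  exact: dvdn_trans (dvdn_gcdr _ _).
have G0 : (0 < G)%N by rewrite (dvdn_gt0 _ Gq).
have Gp i : (G %| `|p 0%R i|)%N.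
  by rewrite /G (bigD1 i) //= dvdn_gcdl.
have zG i : (p 0 i = (p 0%R i %/ G%:Z)%Z * G%:Z).
  by rewrite divzK // -[(_ %| _)%Z]/(_ %| _)%N absz_nat.
exists (\row_i (p 0%R i %/ G%:Z)%Z), (q %/ G)%N; split.
- by rewrite divn_gt0 // dvdn_leq.
- apply/eqP; rewrite -(eqn_pmul2r G0) mul1n; apply/eqP.
  rewrite -{2}/G /G -/G.
  transitivity (\big[gcdn/q]_(i < n) `|p 0%R i|%N) => //.
  apply: (big_rec2 (fun x y => x * G = y)%N); first by rewrite divnK.
  by move=> i y x _ <-; rewrite muln_gcdl mxE [in RHS]zG abszM absz_nat.
- apply/rowP => i; rewrite !mxE [in LHS]zG intrM -{1}(divnK Gq) natrM.
  rewrite -mulf_div divff ?mulr1 //.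
  by rewrite intr_eq0; lia.
Qed.

(** * Dirichlet approximation on a grid *)

Lemma rV_norm_le (R : realType) n (x : 'rV[R]_n) (e : R) : 0 <= e ->
  `|x| <= e <-> forall i, `|x 0 i| <= e.
Proof.
move=> e0; rewrite [`|x|]mx_normrE; split.
  by move=> /bigmax_leP [_ h] i; exact: (h (0, i)).
by move=> h; apply/bigmax_leP; split=> // -[i j] _ /=; rewrite ord1.
Qed.

Section Counting.
Variable R : realType.
Implicit Types (x y z r : R).

Lemma dirichlet n (H : nat) (x : 'rV[R]_n) : (0 < H)%N ->
  exists (q : nat) (a : 'rV[int]_n), (0 < q <= H ^ n)%N /\
    forall i, `|q%:R * x 0 i - (a 0 i)%:~R| < H%:R^-1.
Proof.
case: H => // h _; set H := h.+1.
have H0 : 0 < H%:R :> R by rewrite ltr0n.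
pose fr y := y - (Num.floor y)%:~R.
have fr01 y : 0 <= fr y < 1.
  have := floor_itv y; rewrite intrD /fr; lra.
pose box y := Num.truncn (H%:R * fr y).
have boxP y : (box y)%:R <= H%:R * fr y < (box y).+1%:R.
  by apply: truncn_itv; apply: mulr_ge0; [exact: ltW|case/andP: (fr01 y)].
have box_lt y : (box y < H)%N.
  rewrite -(ltr_nat R); have /andP [h1 _] := boxP y.
  by apply: le_lt_trans h1 _; rewrite gtr_pMr //; case/andP: (fr01 y).
have box_eq y z : box y = box z -> `|fr y - fr z| < H%:R^-1.
  move=> e; have := boxP y; have := boxP z; rewrite e -natr1 => hz hy.
  rewrite -div1r ltr_pdivlMr // -{1}(gtr0_norm H0) -normrM mulrC mulrBr ltr_norml.
  lra.
pose f (j : 'I_(H ^ n).+1) : {ffun 'I_n -> 'I_H} := [ffun i => inord (box (j%:R * x 0 i))].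
have [j [l [jl fjl]]] : exists j l : 'I_(H ^ n).+1, (j < l)%N /\ f j = f l.
  apply: contrapT => noc.
  have finj : injective f.
    move=> j l e; apply: contrapT => /eqP; rewrite neq_ltn => /orP [] jl.
      by apply: noc; exists j, l.
    by apply: noc; exists l, j.
  by have := leq_card f finj; rewrite card_ffun !card_ord ltnn.
exists (l - j)%N.
exists (\row_i (Num.floor (l%:R * x 0 i) - Num.floor (j%:R * x 0 i))); split.
  by rewrite subn_gt0 jl /=; have := ltn_ord l; lia.
move=> i; move/ffunP/(_ i): fjl; rewrite !ffunE => /(congr1 val) /=.
rewrite !inordK // => /box_eq; rewrite distrC /fr mxE natrB ?(ltnW jl) // rmorphB /=.
by congr (`|_| < _); ring.
Qed.

Lemma card_spread T (A : {pred 'I_T}) (w : R) : 0 <= w ->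
  (forall j l : 'I_T, j \in A -> l \in A -> l%:R - j%:R <= w) -> #|A|%:R <= w + 1.
Proof.
move=> w0 Aw; have [i0 iA|A0] := pickP (mem A); last first.
  have -> : #|A| = 0%N by apply: eq_card0.
  by lra.
have [j jA jmin] := @arg_minnP _ i0 (mem A) val iA.
have [l lA lmax] := @arg_maxnP _ i0 (mem A) val iA.
have jl : (j <= l)%N by exact: jmin.
have : (#|A| <= (l - j).+1)%N.
  rewrite cardE -(size_map val) -(size_iota j (l - j).+1).
  apply: uniq_leq_size; first by rewrite map_inj_uniq ?enum_uniq //; exact: val_inj.
  move=> _ /mapP [i + ->]; rewrite mem_enum => iA'; rewrite mem_iota.
  by have := jmin i iA'; have := lmax i iA'; rewrite /=; lia.
rewrite -(ler_nat R) => h; apply: le_trans h _.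
by rewrite -natr1 natrB // lerD2r; exact: Aw.
Qed.

Lemma card_ffun_le n T (A : {pred {ffun 'I_n -> 'I_T}}) (B : 'I_n -> {pred 'I_T}) (p : R) :
  0 <= p -> (forall f i, f \in A -> f i \in B i) -> (forall i, #|B i|%:R <= p) ->
  #|A|%:R <= p ^+ n.
Proof.
move=> p0 AB Bp.
have : (#|A| <= #|(family B : simpl_pred {ffun 'I_n -> 'I_T})|)%N.
  by apply: subset_leq_card; apply/fintype.subsetP => f fA; apply/familyP => i; exact: AB.
rewrite -(ler_nat R) => /le_trans; apply.
rewrite card_family foldrE big_map big_enum /= natr_prod.
apply: (@le_trans _ _ (\prod_(i < n) p)); last by rewrite prodr_const card_ord.
apply: ler_prod => i _.
by rewrite ler0n Bp.
Qed.

Lemma card_le_sum (K L : finType) (A : {pred K}) (B : L -> {pred K}) :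
  (forall k, k \in A -> exists l, k \in B l) -> (#|A| <= \sum_l #|B l|)%N.
Proof.
move=> AB; rewrite -sum1_card (eq_bigr (fun l => \sum_(k in B l) 1)%N); last first.
  by move=> l _; rewrite sum1_card.
rewrite (exchange_big_dep predT) //= [leqRHS](bigID (mem A)) /=.
apply: leq_trans (leq_addr _ _); apply: leq_sum => k kA.
have [l kl] := AB k kA.
by rewrite (bigD1 l).
Qed.

(** As [j] varies, the values sweep an interval of length at most [q * r] in steps of [q * r / T]:
    the first factor counts the integers that can be near, the second the grid points near one of
    them. *)
Lemma card_near_int T (c r h : R) (q : nat) : (0 < q)%N -> (0 < T)%N -> 0 < r -> 0 < h <= 1 ->
  #|[pred j : 'I_T | `[< exists a : int, `|q%:R * (c + r * j%:R / T%:R) - a%:~R| < h >]]|%:R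
    <= (q%:R * r + 3) * (2 * h * T%:R / (q%:R * r) + 1) :> R.
Proof.
move=> q0 T0 r0 /andP [h0 h1].
have qR : 0 < q%:R :> R by rewrite ltr0n.
have TR : 0 < T%:R :> R by rewrite ltr0n.
have qr0 : 0 < q%:R * r by exact: mulr_gt0.
pose W := (Num.truncn (q%:R * r + 2)).+1.
have WP : W%:R <= q%:R * r + 3.
  by rewrite /W -natr1; have := @truncn_le R (q%:R * r + 2); lra.
pose a0 := Num.floor (q%:R * c).
have a0P := floor_itv (q%:R * c); rewrite -/a0 intrD in a0P.
pose B (t : 'I_W) := [pred j : 'I_T | `|q%:R * (c + r * j%:R / T%:R) - (a0 + t%:Z)%:~R| < h].
have AB : forall j, j \in [pred j : 'I_T | `[< exists a : int,
    `|q%:R * (c + r * j%:R / T%:R) - a%:~R| < h >]] ->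
    exists t, j \in B t.
  move=> j; rewrite inE => -[a].
  have jT : 0 <= q%:R * r * (j%:R / T%:R) <= q%:R * r.
    have : 0 <= (j%:R / T%:R : R) <= 1.
      by rewrite divr_ge0 //= ler_pdivrMr // mul1r ler_nat ltnW.
    by move=> /andP [? ?]; rewrite mulr_ge0 ?(ltW qr0) //= ler_piMr // ltW.
  have -> : q%:R * (c + r * j%:R / T%:R) = q%:R * c + q%:R * r * (j%:R / T%:R) by ring.
  rewrite ltr_norml => aj.
  have aa0 : a0 <= a.
    by rewrite -ltzD1 -(ltr_int R) intrD; lra.
  have [t et] : exists t : nat, a = a0 + t%:Z.
    by exists `|a - a0|%N; rewrite gez0_abs ?subr_ge0 // addrCA subrr addr0.
  have tW : (t < W)%N.
    rewrite /W ltnS truncn_ge_nat; last lra.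
    by move: aj; rewrite et intrD -pmulrn; lra.
  by exists (Ordinal tW); rewrite inE /= -et ltr_norml; lra.
have := card_le_sum AB; rewrite -(ler_nat R) => /le_trans; apply.
rewrite natr_sum; apply: (@le_trans _ _ (\sum_(t < W) (2 * h * T%:R / (q%:R * r) + 1))).
  apply: ler_sum => t _; apply: card_spread.
    by rewrite divr_ge0 ?(ltW qr0) // mulr_ge0 ?(ltW TR) //; lra.
  move=> j l; rewrite !inE => hj hl.
  have : q%:R * r * (l%:R - j%:R) < 2 * h * T%:R.
    have -> : q%:R * r * (l%:R - j%:R) = ((q%:R * (c + r * l%:R / T%:R) - (a0 + t%:Z)%:~R)
      - (q%:R * (c + r * j%:R / T%:R) - (a0 + t%:Z)%:~R)) * T%:R.
      by field; lra.
    by rewrite ltr_pM2r //; move: hj hl; rewrite !ltr_norml; lra.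
  by rewrite ler_pdivlMr // mulrC => /ltW.
rewrite sumr_const card_ord -[_ *+ W]mulr_natl; apply: ler_wpM2r => //.
by apply: addr_ge0 => //; rewrite divr_ge0 ?(ltW qr0) // mulr_ge0 ?(ltW TR) //; lra.
Qed.

End Counting.

Section Ubiquity.
Variable R : realType.
Implicit Types (x y z r : R).

Lemma sum_ltn_le (E q : nat) : (\sum_(i < E) (i < q) <= q)%N.
Proof.
suff h : (\sum_(i < E) (i < q) <= minn E q)%N by exact: leq_trans h (geq_minr _ _).
elim: E => [|E IH]; first by rewrite big_ord0.
rewrite big_ord_recr /=; move: IH; set S := (\sum_(i < E) _)%N.
by case: ltnP => /=; lia.
Qed.

(* The points close to some [a / q] with [q <= H ^ n / e] form less than half of
   the grid, so Dirichlet's theorem provides approximations of large denominator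
   for the other grid points. *)
Lemma good_grid n (r : R) : (0 < n)%N -> 0 < r <= 1 ->
  exists H0 : nat, forall H, (H0 <= H)%N -> (0 < H)%N /\ forall c : 'rV[R]_n,
  exists G : {set {ffun 'I_n -> 'I_(H ^ n.+1)}},
    ((H ^ n.+1) ^ n <= 2 * #|G|)%N /\
    forall k, k \in G -> exists (q : nat) (a : 'rV[int]_n), (0 < q <= H ^ n)%N /\
      forall i, `|c 0 i + r * (k i)%:R / (H ^ n.+1)%:R - (a 0 i)%:~R / q%:R|
        <= (4 * 6 ^ n)%:R / (H ^ n.+1)%:R.
Proof.
move=> n0 /andP [r0 r1].
(* Each denominator above [q0] has [1 + 3 / (q * r) <= 2] and spoils at most a proportion
   [(6 / H) ^ n] of the grid; each of the others spoils at most [(3 * K / H) ^ n], up to the term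
   already counted. The factors 4 in [e] and in the bound on [H] hold each kind to a quarter of the
   grid. *)
pose q0 := (Num.truncn (3 / r)).+1.
have q0P : 3 / r < q0%:R by exact: truncnS_gt.
pose K := 1 + 3 / r.
have K0 : 0 <= K by rewrite addr_ge0 // divr_ge0 // ltW.
exists (Num.truncn (4 * 3 ^+ n * q0%:R * K ^+ n)).+1 => H HP.
have {}HP : 4 * 3 ^+ n * q0%:R * K ^+ n <= H%:R.
  apply: ltW; apply: lt_le_trans (truncnS_gt _) _; by rewrite ler_nat.
have H0 : (0 < H)%N.
  rewrite -(ltr_nat R); apply: lt_le_trans HP.
  by rewrite !mulr_gt0 ?exprn_gt0 ?ltr0n // /K addr_gt0 // divr_gt0.
split=> // c.
set T := (H ^ n.+1)%N.
have T0 : (0 < T)%N by rewrite expn_gt0 H0.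
have TR : 0 < T%:R :> R by rewrite ltr0n.
have HR : 0 < H%:R :> R by rewrite ltr0n.
set e := (4 * 6 ^ n)%N.
have e0 : (0 < e)%N by rewrite muln_gt0 expn_gt0.
pose E := (H ^ n %/ e)%N.
pose xk (k : {ffun 'I_n -> 'I_T}) i := c 0 i + r * (k i)%:R / T%:R.
pose near q (k : {ffun 'I_n -> 'I_T}) := `[< exists a : 'rV[int]_n,
  forall i, `|q%:R * xk k i - (a 0 i)%:~R| < H%:R^-1 >].
pose A (q : 'I_E) := [pred k | near q.+1 k].
pose G := [set k | `[< exists q, (E < q <= H ^ n)%N /\ near q k >]]%SET.
have cardA (q : 'I_E) : #|A q|%:R <= (3 * T%:R / H%:R) ^+ n * (2 ^+ n + (q < q0)%N%:R * K ^+ n).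
  have qR : 0 < q.+1%:R :> R by rewrite ltr0n.
  have qr0 : 0 < q.+1%:R * r by rewrite mulr_gt0.
  have qrH : q.+1%:R * r * H%:R <= T%:R.
    rewrite /T expnSr natrM ler_pM2r // (@le_trans _ _ q.+1%:R) //.
      by rewrite ler_piMr // ltW.
    by rewrite ler_nat (leq_trans (ltn_ord q)) // leq_div.
  have c1 i : #|[pred j : 'I_T | `[< exists a : int,
      `|q.+1%:R * (c 0 i + r * j%:R / T%:R) - a%:~R| < H%:R^-1 >]]|%:R
      <= 3 * T%:R / H%:R * (1 + 3 / (q.+1%:R * r)).
    apply: le_trans (card_near_int _ _ _ _ _) _ => //.
      by rewrite invr_gt0 HR invf_le1 // ler1n.
    have -> : 3 * T%:R / H%:R * (1 + 3 / (q.+1%:R * r)) =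
        (q.+1%:R * r + 3) * (2 * H%:R^-1 * T%:R / (q.+1%:R * r) + T%:R / (q.+1%:R * r * H%:R)).
      by field; lra.
    rewrite ler_pM2l; last lra.
    by rewrite lerD2l ler_pdivlMr ?mulr_gt0 // mul1r.
  have pT : 0 <= 3 * T%:R / H%:R :> R by rewrite divr_ge0 ?(ltW HR) // mulr_ge0 ?(ltW TR).
  have u0 : 0 <= 1 + 3 / (q.+1%:R * r) by rewrite addr_ge0 // divr_ge0 // ltW.
  have p0 := mulr_ge0 pT u0.
  apply: le_trans (card_ffun_le p0 _ c1) _.
    move=> k i; rewrite !inE => -[a ka]; exists (a 0 i); exact: ka.
  rewrite exprMn; apply: ler_wpM2l; first exact: exprn_ge0.
  case: ltnP => qq0.
    rewrite mul1r; apply: (@le_trans _ _ (K ^+ n)); last by rewrite lerDr exprn_ge0.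
    apply: lerXn2r; rewrite ?nnegrE // /K lerD2l ler_wpM2l // lef_pV2 ?posrE //.
    by rewrite ler_peMl ?(ltW r0) // ler1n.
  rewrite mul0r addr0; apply: lerXn2r; rewrite ?nnegrE //.
  set u := 3 / _; suff : u <= 1 by lra.
  rewrite /u.
  rewrite ler_pdivrMr // mul1r; move: q0P; rewrite ltr_pdivrMr // => /ltW h.
  by apply: le_trans h _; rewrite ler_pM2r // ler_nat; exact: leqW.
have cardG : (T ^ n <= #|G| + \sum_q #|A q|)%N.
  have -> : (T ^ n = #|{: {ffun 'I_n -> 'I_T}}|)%N by rewrite card_ffun !card_ord.
  rewrite -(cardC (mem G)) leq_add2l.
  apply: card_le_sum => k kG.
  have [q [a [/andP [q1 qH] qa]]] := dirichlet (\row_i xk k i) H0.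
  have kq : near q k by apply/asboolP; exists a => i; have := qa i; rewrite mxE.
  have qE : (q.-1 < E)%N.
    rewrite prednK // leqNgt; apply/negP => Eq.
    suff kG' : k \in G by case/negP: (kG : ~~ (k \in G)).
    by rewrite finset.in_set; apply/asboolP; exists q; rewrite Eq.
  by exists (Ordinal qE); rewrite -[_ \in _]/(near q.-1.+1 k) prednK.
exists G; split.
  suff : \sum_q #|A q|%:R <= T%:R ^+ n / 2 :> R.
    rewrite -natr_sum -natrX => h; have : (T ^ n)%:R <= (#|G| + \sum_q #|A q|)%:R :> R by rewrite ler_nat.
    rewrite natrD => h'; rewrite -(ler_nat R) natrM; lra.
  apply: le_trans (ler_sum _ (fun q _ => cardA q)) _.
  rewrite -mulr_sumr big_split /= sumr_const card_ord -mulr_suml -natr_sum.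
  have hE : 6 ^+ n * E%:R <= H%:R ^+ n / 4 :> R.
    have : (E * e <= H ^ n)%N by exact: leq_divM.
    by rewrite -(ler_nat R) /e !natrM !natrX; lra.
  have hK : 3 ^+ n * q0%:R * K ^+ n <= H%:R ^+ n / 4.
    have : H%:R <= H%:R ^+ n :> R by apply: ler_eXnr => //; rewrite ler1n.
    by lra.
  have hS : (\sum_(i < E) (i < q0))%N%:R <= q0%:R :> R by rewrite ler_nat sum_ltn_le.
  have Hn0 : 0 < H%:R ^+ n :> R by rewrite exprn_gt0.
  have -> : (3 * T%:R / H%:R) ^+ n = T%:R ^+ n / H%:R ^+ n * 3 ^+ n :> R.
    by rewrite !exprMn exprVn; ring.
  apply: (@le_trans _ _ (T%:R ^+ n / H%:R ^+ n * (H%:R ^+ n / 2))); last first.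
    rewrite le_eqVlt; apply/orP; left; apply/eqP; field; lra.
  rewrite -[X in X <= _]mulrA; apply: ler_wpM2l; first by rewrite divr_ge0 ?exprn_ge0 ?(ltW TR) ?(ltW HR).
  have e6 : 6 ^+ n = 3 ^+ n * 2 ^+ n :> R by rewrite -exprMn; congr (_ ^+ _); lra.
  have : 3 ^+ n * ((\sum_(i < E) (i < q0))%N%:R * K ^+ n) <= 3 ^+ n * (q0%:R * K ^+ n).
    by rewrite ler_wpM2l ?exprn_ge0 // ler_wpM2r ?exprn_ge0.
  move: hE; rewrite e6 -[_ *+ E]mulr_natr; lra.
(* As [q > H ^ n / e], dividing [|q * x - a| < 1 / H] by [q] gives an error of at most
   [e / H ^ n.+1]. *)
move=> k; rewrite inE => /asboolP [q [/andP [Eq qH] /asboolP [a ka]]].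
have q1 : (0 < q)%N by apply: leq_trans Eq.
have qR : 0 < q%:R :> R by rewrite ltr0n.
exists q, a; rewrite q1 qH; split=> // i.
have := ka i; rewrite /xk => /ltW h.
have -> : c 0 i + r * (k i)%:R / T%:R - (a 0 i)%:~R / q%:R =
    (q%:R * (c 0 i + r * (k i)%:R / T%:R) - (a 0 i)%:~R) / q%:R by field; lra.
rewrite normrM normfV (gtr0_norm qR) ler_pdivrMr //; apply: le_trans h _.
rewrite -div1r ler_pdivrMr //.
have -> : e%:R / T%:R * q%:R * H%:R = (e%:R * q%:R * H%:R) / T%:R :> R by ring.
rewrite ler_pdivlMr // mul1r -!natrM ler_nat.
rewrite /T expnSr leq_mul2r; apply/orP; right.
by rewrite mulnC; apply: ltnW; rewrite -ltn_divLR.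
Qed.

End Ubiquity.

(** * Nested cubes avoiding a cover *)

Section NestedCubes.
Variable R : realType.

Lemma powR_ge_eventually (t C : R) : 0 < t ->
  exists H0 : nat, forall H, (H0 <= H)%N -> C <= H%:R `^ t.
Proof.
move=> t0; exists (Num.truncn (`|C| `^ t^-1)).+1 => H H0.
have : `|C| `^ t^-1 <= H%:R.
  by apply: ltW; apply: lt_le_trans (truncnS_gt _) _; rewrite ler_nat.
move=> /(ge0_ler_powR (ltW t0)) h; apply: le_trans (ler_norm _) _.
have -> : `|C| = (`|C| `^ t^-1) `^ t by rewrite -powRrM mulVf ?gt_eqF // powRr1.
by apply: h; rewrite nnegrE ?powR_ge0.
Qed.

Definition cube n (c : 'rV[R]_n) (r : R) : set 'rV[R]_n :=
  [set x | forall i, c 0 i <= x 0 i <= c 0 i + r].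

Variables (n : nat) (s : R).
Variables (U : nat -> set 'rV[R]_n) (d : nat -> R).
Hypothesis n0 : (0 < n)%N.
Hypothesis s0 : 0 < s.
Hypothesis sn : s < n%:R.
Hypothesis d0 : forall i, 0 < d i.
Hypothesis Ud : forall i x y, U i x -> U i y -> `|x - y| <= d i.

Definition meets (c : 'rV[R]_n) (r : R) (i : nat) : bool := `[< U i `&` cube c r !=set0 >].

(** Truncation at [N] keeps the sums finite; bounds are stated for all [N], and monotonicity lets
    one large [N] serve finitely many cubes. *)
Definition weight (c : 'rV[R]_n) (r : R) (N : nat) : R := \sum_(i < N | meets c r i) d i `^ s.

(* 44 is chosen so that [(11 / 44) ^+ n <= 1 / 4] in [light_child]. *)
Definition light (c : 'rV[R]_n) (r : R) := forall N, weight c r N <= (r / 44) `^ s.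

Lemma meets_sub c r c' r' i : cube c' r' `<=` cube c r -> meets c' r' i -> meets c r i.
Proof.
by move=> sub /asboolP [x [Ux cx]]; apply/asboolP; exists x; split=> //; exact: sub.
Qed.

Lemma weight_mono c r N M : (N <= M)%N -> weight c r N <= weight c r M.
Proof.
move=> NM; rewrite /weight -!(big_mkord (fun i => meets c r i) (fun i => d i `^ s)).
rewrite [leRHS](big_cat_nat (leq0n N) NM) /=; apply: ler_wpDr => //.
by apply: sumr_ge0 => i _; exact: powR_ge0.
Qed.

(** A single set may not outweigh the cube. In the limit this excludes [U i]: a light cube of side
    below [44 * d i] does not meet it. *)
Lemma light_d c r i : 0 < r -> light c r -> meets c r i -> d i <= r / 44.
Proof.
move=> r0 lc mi; have : d i `^ s <= (r / 44) `^ s.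
  apply: le_trans (lc i.+1); rewrite /weight big_mkcond big_ord_recr /= mi.
  by apply: ler_wpDl => //; apply: sumr_ge0 => j _; case: ifP => // _; exact: powR_ge0.
have r44 : 0 <= r / 44 by lra.
move=> /(ge0_ler_powR (r := s^-1)).
rewrite -!powRrM mulfV ?gt_eqF // !powRr1 ?(ltW (d0 _)) //.
by apply; rewrite ?nnegrE ?powR_ge0 // invr_ge0 ltW.
Qed.

(* Among the cubes [C k], those meeting a set of diameter at least [rho] are at
   most a quarter of the grid, and the other sets meet boundedly many cubes. *)
Lemma light_child (T : nat) (G : {set {ffun 'I_n -> 'I_T}}) c r (e rho w : R)
    (xk : {ffun 'I_n -> 'I_T} -> 'rV[R]_n) (C : {ffun 'I_n -> 'I_T} -> 'rV[R]_n) (r' : R) :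
  0 < r <= 1 -> 1 <= e -> (0 < T)%N -> rho = e / T%:R -> (T ^ n <= 2 * #|G|)%N ->
  light c r ->
  (forall k i, xk k 0 i = c 0 i + r / 4 + r / 2 * (k i)%:R / T%:R) ->
  (forall k, k \in G -> cube (C k) r' `<=` cube c r) ->
  (forall k y i, k \in G -> cube (C k) r' y -> `|y 0 i - xk k 0 i| <= 2 * rho) ->
  4 * (11 * e / r) ^+ n * (r / 44) `^ s <= w * T%:R ^+ n ->
  exists2 k, k \in G & forall N, weight (C k) r' N <= w.
Proof.
move=> /andP [r0 r1] e1 T0 erho GT lc xkE Csub Cx hw.
have TR : 0 < T%:R :> R by rewrite ltr0n.
have rho0 : 0 < rho by rewrite erho divr_gt0 //; lra.
(* Grid points are [r / (2 * T)] apart in each coordinate, and those of two cubes meeting [U i]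
   differ by at most [d i + 4 * rho]. *)
have card_meet (i : nat) : #|[pred k in G | meets (C k) r' i]|%:R
    <= ((d i + 4 * rho) * 2 * T%:R / r + 1) ^+ n.
  have p0 : 0 <= (d i + 4 * rho) * 2 * T%:R / r.
    rewrite divr_ge0 ?(ltW r0) // mulr_ge0 ?(ltW TR) // mulr_ge0 //.
    by have := d0 i; lra.
  pose B j := [pred t : 'I_T | [exists k in [pred k in G | meets (C k) r' i], k j == t]].
  apply: (@card_ffun_le _ _ _ _ B) => [|f j fA|j]; first lra.
    by rewrite inE; apply/existsP; exists f; rewrite fA eqxx.
  apply: card_spread => // t u; rewrite !inE.
  move=> /existsP [k /andP [/andP [kG /asboolP [y [Uy Cy]]] /eqP <-]].
  move=> /existsP [l /andP [/andP [lG /asboolP [z [Uz Cz]]] /eqP <-]].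
  have yz : `|(z - y) 0 j| <= d i.
    by move: j; apply/rV_norm_le; [exact: ltW|exact: Ud].
  have := Cx _ _ j kG Cy; have := Cx _ _ j lG Cz; rewrite !xkE.
  move: yz; rewrite !mxE !ler_norml => yz hl hk.
  rewrite ler_pdivlMr //.
  have : (l j)%:R * (r / T%:R) - (k j)%:R * (r / T%:R) <= (d i + 4 * rho) * 2 by lra.
  rewrite -mulrBl mulrA ler_pdivrMr //.
have rhoT : rho * T%:R = e by rewrite erho divfK ?gt_eqF.
have bound_nneg i : 0 <= (d i + 4 * rho) * 2 * T%:R / r + 1.
  apply: addr_ge0 => //; rewrite divr_ge0 ?(ltW r0) // mulr_ge0 ?(ltW TR) // mulr_ge0 //.
  by have := d0 i; lra.
(* Here 11 is [2 * (1 + 4) + 1]: both [d i] and [rho] are replaced by the larger of the two, and the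
   final 1 is absorbed because [r <= 1 <= e]. *)
have small i : d i < rho -> #|[pred k in G | meets (C k) r' i]|%:R <= (11 * e / r) ^+ n.
  move=> di; apply: le_trans (card_meet i) _.
  apply: lerXn2r; rewrite ?nnegrE //; first by rewrite divr_ge0 ?(ltW r0) //; lra.
  have : d i * T%:R <= e by rewrite -rhoT ler_wpM2r ?ltW.
  rewrite -(ler_pM2r r0) mulrDl !divfK ?gt_eqF //; lra.
have big i : rho <= d i -> #|[pred k in G | meets (C k) r' i]|%:R <= (11 * d i * T%:R / r) ^+ n.
  move=> di; apply: le_trans (card_meet i) _.
  apply: lerXn2r; rewrite ?nnegrE //.
    by rewrite divr_ge0 ?(ltW r0) // !mulr_ge0 // ltW.
  have : e <= d i * T%:R by rewrite -rhoT ler_wpM2r // ltW.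
  rewrite -(ler_pM2r r0) mulrDl !divfK ?gt_eqF //; lra.
pose Bad N := [pred k in G | [exists i : 'I_N, (rho <= d i) && meets (C k) r' i]].
have cardBad N : #|Bad N|%:R <= T%:R ^+ n / 4 :> R.
  pose B (i : 'I_N) := [pred k in G | [&& meets c r i, rho <= d i & meets (C k) r' i]].
  have : (#|Bad N| <= \sum_i #|B i|)%N.
    apply: card_le_sum => k /andP [kG /existsP [i /andP [di mi]]].
    by exists i; rewrite !inE kG di mi (meets_sub (Csub k kG) mi).
  rewrite -(ler_nat R) natr_sum => /le_trans; apply.
  (* Here [s < n] enters: since [d i <= r / 44], the power [d i ^ n] is at most
     [(r / 44) ^ (n - s) * d i ^ s], and lightness of the parent sums the last factors. What remains
     is [(11 * T / 44) ^ n]. *)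
  apply: (@le_trans _ _ (\sum_(i < N | meets c r i) (T%:R * 11 / r) ^+ n * (r / 44) `^ (n%:R - s) * d i `^ s)).
    rewrite [leRHS]big_mkcond; apply: ler_sum => i _.
    case mi : (meets c r i); last first.
      by rewrite (_ : #|B i| = 0%N) //; apply: eq_card0 => k; rewrite !inE mi andbF.
    have [di|di] := leP rho (d i); last first.
      rewrite (_ : #|B i| = 0%N); first by rewrite !mulr_ge0 ?powR_ge0 // exprn_ge0 // divr_ge0 ?mulr_ge0 // ltW.
      by apply: eq_card0 => k; rewrite !inE leNgt di /= !andbF.
    apply: (@le_trans _ _ #|[pred k in G | meets (C k) r' i]|%:R).
      rewrite ler_nat; apply: subset_leq_card; apply/fintype.subsetP => k.
      by rewrite !inE => /andP [-> /and3P [_ _ ->]].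
    apply: le_trans (big i di) _.
    have -> : 11 * d i * T%:R / r = T%:R * 11 / r * d i by ring.
    rewrite exprMn -[leRHS]mulrA ler_wpM2l ?exprn_ge0 ?divr_ge0 ?mulr_ge0 ?(ltW r0) //.
    rewrite -powR_mulrn ?(ltW (d0 _)) //.
    rewrite -{1}(subrK s n%:R) powRD ?(gt_eqF (d0 i)) ?implybT // ler_wpM2r ?powR_ge0 //.
    apply: ge0_ler_powR; rewrite ?nnegrE ?subr_ge0 ?divr_ge0 ?(ltW sn) ?(ltW (d0 _)) ?(ltW r0) //.
    exact: light_d.
  rewrite -mulr_sumr; apply: (@le_trans _ _ ((T%:R * 11 / r) ^+ n * (r / 44) `^ (n%:R - s) * (r / 44) `^ s)).
    by apply: ler_wpM2l; [rewrite mulr_ge0 ?powR_ge0 // exprn_ge0 // divr_ge0 ?mulr_ge0 // ltW|exact: lc].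
  have r44 : 0 < r / 44 by lra.
  rewrite -mulrA -powRD ?(gt_eqF r44) ?implybT // subrK powR_mulrn ?(ltW r44) // -exprMn.
  have -> : T%:R * 11 / r * (r / 44) = T%:R / 4 by field; lra.
  rewrite exprMn ler_wpM2l ?exprn_ge0 ?(ltW TR) //.
  by case: (n) n0 => // p _; rewrite exprS ler_piMr // exprn_ile1 //; lra.
apply: contrapT => nok.
have /choice [F FP] : forall k, exists N, k \in G -> w < weight (C k) r' N.
  move=> k; have [kG|] := boolP (k \in G); last by exists 0%N.
  have : ~ forall N, weight (C k) r' N <= w by move=> h; apply: nok; exists k.
  by move=> /existsNP [N /negP]; rewrite -ltNge => h; exists N.
pose N := (\max_(k in G) F k)%N.
have {}FP k : k \in G -> w < weight (C k) r' N.
  move=> kG; apply: lt_le_trans (FP k kG) _; apply: weight_mono.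
  exact: leq_bigmax_cond.
pose G' := [pred k in G | ~~ (k \in Bad N)].
have cardG' : T%:R ^+ n / 4 <= #|G'|%:R :> R.
  have : (#|G| <= #|Bad N| + #|G'|)%N.
    rewrite -(cardID (mem (Bad N)) (mem G)); apply: leq_add; apply: subset_leq_card.
      by apply/fintype.subsetP => k; rewrite !inE => /andP [].
    by apply/fintype.subsetP => k; rewrite !inE andbC.
  have := cardBad N; have := GT; rewrite -!(ler_nat R) natrM natrX natrD; lra.
(* Double counting: over [G'] only sets with [d i < rho] contribute, each to at most
   [(11 * e / r) ^ n] cubes. The factor 4 in the condition on [w] pays for [G'] being only a quarter
   of the grid. *)
have up : \sum_(k in G') weight (C k) r' N <= (11 * e / r) ^+ n * (r / 44) `^ s.
  rewrite /weight (exchange_big_dep (fun i : 'I_N => meets c r i)) /=; last first.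
    by move=> k i /andP [kG _]; exact/meets_sub/Csub.
  have e11 : 0 <= 11 * e / r by rewrite divr_ge0 ?(ltW r0) //; lra.
  apply: (@le_trans _ _ ((11 * e / r) ^+ n * weight c r N)); last first.
    by apply: ler_wpM2l; [exact: exprn_ge0|exact: lc].
  rewrite /weight mulr_sumr; apply: ler_sum => i mi.
  rewrite sumr_const -[_ *+ _]mulr_natl ler_wpM2r ?powR_ge0 //.
  have [di|di] := leP rho (d i).
    rewrite (_ : #|_| = 0%N) ?exprn_ge0 //; apply: eq_card0 => k.
    apply/negP => /andP [/andP [kG /negP kB] mk]; apply: kB.
    by apply/andP; split=> //; apply/existsP; exists i; rewrite di mk.
  apply: le_trans (small i di); rewrite ler_nat; apply: subset_leq_card.
  by apply/fintype.subsetP => k /andP [/andP [kG _] mk]; rewrite !inE; apply/andP.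
have low : #|G'|%:R * w < \sum_(k in G') weight (C k) r' N.
  rewrite mulr_natl -sumr_const; apply: ltr_sum; last first.
    by move=> k /andP [kG _]; exact: FP.
  have : 0 < #|G'|%:R :> R.
    by apply: lt_le_trans cardG'; rewrite divr_gt0 // exprn_gt0.
  by rewrite ltr0n => /card_gt0P [k kG']; apply/hasP; exists k => //.
have w0 : 0 <= w.
  rewrite -(pmulr_lge0 _ (exprn_gt0 n TR)); apply: le_trans hw.
  by rewrite !mulr_ge0 ?powR_ge0 // exprn_ge0 // divr_ge0 ?(ltW r0) //; lra.
have : T%:R ^+ n / 4 * w <= #|G'|%:R * w by exact: ler_wpM2r.
move: hw; have := lt_le_trans low up; move: (_ ^+ n) (_ `^ s) => A B; lra.
Qed.

End NestedCubes.

(** Two exponents decide. Children of side about [H ^ (- n * sigma)] are within the grid error,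
    about [H ^ (- n.+1)], because [n.+1 <= n * sigma]; one of them is light for large [H] because
    [sigma * s < n.+1] makes [H ^ (n * (n.+1 - sigma * s))] grow. *)
Lemma light_step (R : realType) n (s : R) (U : nat -> set 'rV[R]_n) (d : nat -> R)
    (sigma L : R) (c : 'rV[R]_n) (r : R) :
  (0 < n)%N -> 0 < s -> s < n%:R -> (forall i, 0 < d i) ->
  (forall i x y, U i x -> U i y -> `|x - y| <= d i) ->
  1 <= L -> n.+1%:R <= n%:R * sigma -> sigma * s < n.+1%:R ->
  0 < r <= 1 -> light s U d c r ->
  exists c' r' (a : 'rV[int]_n) (q : nat), [/\ 0 < r' <= r / 2, light s U d c' r',
    cube c' r' `<=` cube c r, (0 < q)%N &
    forall x, cube c' r' x -> [/\ x != ratpoint R a q,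
      `|x - ratpoint R a q| <= 2 * r' & `|x - ratpoint R a q| <= q%:R `^ (- sigma) / L]].
Proof.
move=> n0 s0 sn d0 Ud L1 sigma_n sigma_s r01 lcr.
have sigma0 : 0 < sigma.
  rewrite -(pmulr_rgt0 _ (_ : 0 < n%:R)) ?ltr0n //.
  by apply: lt_le_trans sigma_n; rewrite ltr0n.
have /andP [r0 r1] := r01.
have L0 : 0 < L by lra.
have [|H1 H1P] := @good_grid R n (r / 2) n0; first by lra.
set e := (4 * 6 ^ n)%N in H1P.
have e1 : 1 <= e%:R :> R by rewrite ler1n muln_gt0 expn_gt0.
have theta0 : 0 < n%:R * (n.+1%:R - sigma * s) :> R by rewrite mulr_gt0 ?ltr0n // subr_gt0.
(* [88 = 2 * 44]: the child has side [delta / 2], and lightness divides the side by 44. *)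
pose K := (88 * L) `^ (- s).
have K0 : 0 < K by rewrite powR_gt0 //; lra.
have [H2 H2P] := @powR_ge_eventually R _
  (4 * (11 * e%:R / r) ^+ n * (r / 44) `^ s / K) theta0.
(* This yields [8 * rho <= r]: the grid fills the middle half of the cube, and children stray from
   their grid points by at most [2 * rho <= r / 4]. *)
pose H3 := (Num.truncn (8 * e%:R / r)).+1.
pose H := maxn H1 (maxn H2 H3).
have [H0 {}H1P] := H1P H (leq_maxl _ _).
have {}H2P : 4 * (11 * e%:R / r) ^+ n * (r / 44) `^ s / K
    <= H%:R `^ (n%:R * (n.+1%:R - sigma * s)).
  by apply: H2P; rewrite /H !leq_max leqnn orbT.
have H3P : 8 * e%:R / r <= H%:R.
  apply: ltW; apply: lt_le_trans (truncnS_gt _) _.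
  by rewrite ler_nat -/H3 /H !leq_max leqnn !orbT.
have HR : 1 <= H%:R :> R by rewrite ler1n.
have HR0 : 0 < H%:R :> R by lra.
have [G [cardG GP]] := H1P (\row_i (c 0 i + r / 4)).
set T := (H ^ n.+1)%N in G cardG GP.
have TH : T%:R = H%:R `^ n.+1%:R :> R by rewrite natrX powR_mulrn // ltW.
have T0 : (0 < T)%N by rewrite expn_gt0 H0.
have TR : 0 < T%:R :> R by rewrite ltr0n.
pose rho : R := e%:R / T%:R.
have rho0 : 0 < rho by rewrite divr_gt0 //; lra.
have rhor : 8 * rho <= r.
  have : H%:R <= T%:R :> R by rewrite ler_nat /T -[leqLHS]expn1 leq_pexp2l.
  move=> /(le_trans H3P); rewrite ler_pdivrMr // => h.
  by rewrite /rho mulrA ler_pdivrMr // [leRHS]mulrC.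
pose delta := (H ^ n)%N%:R `^ (- sigma) / L.
have HnR : 1 <= (H ^ n)%N%:R :> R by rewrite ler1n expn_gt0 H0.
have deltaE : delta = H%:R `^ (- (n%:R * sigma)) / L.
  by rewrite /delta natrX -powR_mulrn ?(ltW HR0) // -powRrM mulrN.
have delta0 : 0 < delta by rewrite divr_gt0 // powR_gt0 //; lra.
have delta_rho : delta <= rho.
  apply: (@le_trans _ _ (H%:R `^ (- (n%:R * sigma)))).
    by rewrite deltaE ler_pdivrMr // ler_peMr // powR_ge0.
  apply: (@le_trans _ _ (H%:R `^ (- n.+1%:R))); first by rewrite ler_powR // lerN2.
  by rewrite powRN -TH /rho -[leLHS]mul1r ler_pM2r // invr_gt0.
have /choice [F FP] : forall k, exists aq : 'rV[int]_n * nat, k \in G ->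
    (0 < aq.2 <= H ^ n)%N /\ forall i, `|(c 0 i + r / 4 + r / 2 * (k i)%:R / T%:R)
      - (aq.1 0 i)%:~R / aq.2%:R| <= rho.
  move=> k; have [kG|] := boolP (k \in G); last by exists (0, 0%N).
  have [q [a [qH h]]] := GP k kG; exists (a, q) => _; split=> // i.
  by have := h i; rewrite mxE.
(* The offset [delta / 2] keeps the child within [delta] of the rational point but away from it, so
   that later steps must produce new approximants. *)
pose C k := ratpoint R (F k).1 (F k).2 + const_mx (delta / 2).
have Cin k y i : k \in G -> cube (C k) (delta / 2) y ->
    delta / 2 <= y 0 i - ratpoint R (F k).1 (F k).2 0 i <= delta.
  by move=> kG /(_ i); rewrite 3!mxE; lra.
have Cx k y i : k \in G -> cube (C k) (delta / 2) y ->
    `|y 0 i - (\row_i (c 0 i + r / 4 + r / 2 * (k i)%:R / T%:R)) 0 i| <= 2 * rho.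
  move=> kG yC; have := Cin k y i kG yC; have [_ /(_ i)] := FP k kG.
  by rewrite !mxE !ler_norml; lra.
have Csub k : k \in G -> cube (C k) (delta / 2) `<=` cube c r.
  move=> kG y yC i; have := Cx k y i kG yC; rewrite mxE ler_norml.
  have : 0 <= r / 2 * ((k i)%:R / T%:R) <= r / 2.
    have kT : (k i)%:R / T%:R <= 1 :> R.
      by rewrite ler_pdivrMr // mul1r ler_nat ltnW.
    by rewrite mulr_ge0 ?divr_ge0 ?ler_piMr //; lra.
  by rewrite mulrA; lra.
have hw : 4 * (11 * e%:R / r) ^+ n * (r / 44) `^ s <= (delta / 2 / 44) `^ s * T%:R ^+ n.
  move: H2P; rewrite ler_pdivrMr // => /le_trans; apply.
  have -> : delta / 2 / 44 = H%:R `^ (- (n%:R * sigma)) * (88 * L)^-1.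
    by rewrite deltaE; field; lra.
  rewrite powRM ?powR_ge0 //; last by rewrite invr_ge0; lra.
  rewrite -powR_inv1; last lra.
  rewrite -!powRrM mulN1r -/K -powR_mulrn ?(ltW TR) // TH -powRrM mulrAC.
  rewrite -powRD; last by rewrite (gt_eqF HR0) implybT.
  by rewrite le_eqVlt; apply/orP; left; apply/eqP; congr (_ `^ _ * _); ring.
have [k kG kl] := @light_child R n s U d n0 s0 sn d0 Ud T G c r e%:R rho
  ((delta / 2 / 44) `^ s) _ C (delta / 2) r01 e1 T0 erefl cardG lcr
  (fun k i => mxE _ _ _ _) Csub Cx hw.
have [/andP [q0 qH] _] := FP k kG.
exists (C k), (delta / 2), (F k).1, (F k).2; split=> //.
- by rewrite divr_gt0 //=; lra.
- exact: Csub.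
- move=> x xC; have hx i := Cin k x i kG xC.
  have xd : `|x - ratpoint R (F k).1 (F k).2| <= delta.
    apply/rV_norm_le; first exact: ltW.
    by move=> i; have := hx i; rewrite !mxE ler_norml; lra.
  split.
  + apply/eqP => e'; have := hx (Ordinal n0); rewrite e'; lra.
  + by lra.
  + apply: le_trans xd _; rewrite ler_pM2r ?invr_gt0 // !powRN.
    rewrite lef_pV2 ?posrE ?powR_gt0 ?ltr0n ?expn_gt0 ?H0 //.
    apply: ge0_ler_powR; rewrite ?nnegrE //; [exact: ltW|by rewrite ler_nat].
Qed.

Lemma seq_dist_pos (R : realType) n (x : 'rV[R]_n) (l : seq 'rV[R]_n) :
  exists2 e : R, 0 < e & forall y, y \in l -> x != y -> e <= `|x - y|.
Proof.
elim: l => [|z l [e e0 IH]]; first by exists 1.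
have [<-|xz] := eqVneq x z.
  by exists e => // y; rewrite inE => /orP [/eqP -> /eqP //|]; exact: IH.
exists (Num.min e `|x - z|); first by rewrite lt_min e0 normr_gt0 subr_eq0.
move=> y; rewrite inE ge_min => /orP [/eqP -> _|yl xy]; first by rewrite lexx orbT.
by rewrite IH.
Qed.

Lemma pow2_small (R : realType) (e : R) : 0 < e -> exists k : nat, 2^-1 ^+ k < e.
Proof.
move=> e0; exists (Num.truncn e^-1).+1.
rewrite exprVn -[ltRHS]invrK ltf_pV2 ?posrE ?exprn_gt0 ?invr_gt0 //.
apply: lt_trans (truncnS_gt _) _; set k := _.+1.
by rewrite -natrX ltr_nat ltn_expl.
Qed.

Lemma avoiding_point (R : realType) n (s : R) (U : nat -> set 'rV[R]_n) (d : nat -> R)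
    (sigma L : R) :
  (0 < n)%N -> 0 < s -> s < n%:R -> (forall i, 0 < d i) ->
  (forall i x y, U i x -> U i y -> `|x - y| <= d i) ->
  1 <= L -> n.+1%:R <= n%:R * sigma -> sigma * s < n.+1%:R ->
  (forall N, \sum_(i < N) d i `^ s <= 44^-1 `^ s) ->
  exists x : 'rV[R]_n, [/\ forall i, 0 <= x 0 i <= 1, forall i, ~ U i x &
    infinite_set [set y | exists (a : 'rV[int]_n) (q : nat),
      [/\ (0 < q)%N, y = ratpoint R a q & `|x - y| <= q%:R `^ (- sigma) / L]]].
Proof.
move=> n0 s0 sn d0 Ud L1 sigma_n sigma_s dN.
pose state := {p : 'rV[R]_n * R | 0 < p.2 <= 1 /\ light s U d p.1 p.2}.
have light0 : 0 < (0 : 'rV[R]_n, 1 : R).2 <= 1 /\ light s U d (0 : 'rV[R]_n) 1.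
  split; first by rewrite /= ltr01 lexx.
  move=> N; rewrite div1r; apply: le_trans (dN N); rewrite /weight [leLHS]big_mkcond.
  by apply: ler_sum => i _; case: ifP => // _; exact: powR_ge0.
pose st0 : state := exist _ (0, 1) light0.
have /choice [f fP] : forall p : state, exists p' : state,
    [/\ (sval p').2 <= (sval p).2 / 2,
      cube (sval p').1 (sval p').2 `<=` cube (sval p).1 (sval p).2 &
      exists (a : 'rV[int]_n) (q : nat), (0 < q)%N /\
      forall x, cube (sval p').1 (sval p').2 x -> [/\ x != ratpoint R a q,
      `|x - ratpoint R a q| <= 2 * (sval p').2 & `|x - ratpoint R a q| <= q%:R `^ (- sigma) / L]].
  move=> [[c r] /= [r01 lcr]].
  have [c' [r' [a [q [/andP [r'0 r'r] lcr' sub q0 h]]]]] :=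
    light_step n0 s0 sn d0 Ud L1 sigma_n sigma_s r01 lcr.
  have Pr : 0 < (c', r').2 <= 1 /\ light s U d (c', r').1 (c', r').2.
    by split=> //=; apply/andP; split=> //; move/andP: r01; lra.
  by exists (exist _ (c', r') Pr); split=> //=; exists a, q.
pose st k := iter k f st0.
pose c k := (sval (st k)).1; pose r k := (sval (st k)).2.
have r0 k : 0 < r k by case: (svalP (st k)) => /andP [].
have lst k : light s U d (c k) (r k) by case: (svalP (st k)).
have rS k : r k.+1 <= r k / 2 by case: (fP (st k)).
have sub1 k : cube (c k.+1) (r k.+1) `<=` cube (c k) (r k) by case: (fP (st k)).
have r2 k : r k <= 2^-1 ^+ k.
  elim: k => [|k IH]; first by rewrite expr0.
  by apply: le_trans (rS k) _; rewrite exprSr ler_pM2r.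
have sub k l : (k <= l)%N -> cube (c l) (r l) `<=` cube (c k) (r k).
  move=> /subnK <-; elim: (l - k)%N => [//|j IH].
  by apply: subset_trans IH; rewrite addSn; exact: sub1.
have cin k : cube (c k) (r k) (c k) by move=> i; rewrite lexx lerDl ltW.
have cc i k l : c l 0 i <= c k 0 i + r k.
  have [lk|/ltnW kl] := leqP l k; last by have /andP [] := sub _ _ kl _ (cin l) i.
  have /andP [h _] := sub _ _ lk _ (cin k) i.
  by apply: le_trans h _; rewrite lerDl ltW.
pose x : 'rV[R]_n := \row_i sup (range (fun k => c k 0 i)).
have xin k : cube (c k) (r k) x.
  move=> i; rewrite mxE; apply/andP; split.
    apply: ub_le_sup; last by exists k.
    by exists (c k 0 i + r k) => _ [l _ <-]; exact: cc.
  apply: ge_sup; first by exists (c 0%N 0 i); exists 0%N.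
  by move=> _ [l _ <-]; exact: cc.
exists x; split.
- by move=> i; have := xin 0%N i; rewrite /c /r /= mxE add0r.
- move=> i Ux; have [k kd] := pow2_small (d0 i).
  have mk : meets U (c k) (r k) i by apply/asboolP; exists x; split=> //; exact: xin.
  have := light_d s0 d0 (r0 k) (lst k) mk.
  by have := r2 k; have := r0 k; lra.
(* The approximants found differ from [x] and come arbitrarily close to it, so no finite list
   contains them all. *)
- set Y := [set y | _] => /finite_seqP [l Yl].
  have [e e0 eP] := seq_dist_pos x l.
  have e20 : 0 < e / 2 by lra.
  have [k ke] := pow2_small e20.
  have [_ _ [a [q [q0 /(_ x (xin k.+1)) [xy xy1 xy2]]]]] := fP (st k).
  have yl : ratpoint R a q \in l.
    have : Y (ratpoint R a q) by exists a, q.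
    by rewrite Yl.
  have := eP _ yl xy.
  have : r k.+1 < e / 2.
    by apply: le_lt_trans ke; apply: le_trans (rS k) _; have := r2 k; have := r0 k; lra.
  by move: xy1; rewrite -/(st k.+1) -/(r k.+1); lra.
Qed.

(** * Rational points near the graph *)

Lemma norm_coord (R : realType) n (x : 'rV[R]_n) i : `|x 0 i| <= `|x|.
Proof. by move: i; apply/rV_norm_le. Qed.

Section Lipschitz.
Variables (R : realType) (n : nat) (M : R).
Implicit Types f g : 'rV[R]_n -> R.

Let box (x : 'rV[R]_n) := `|x| <= M.

(** The bound accompanies the Lipschitz constant because products need it. *)
Definition bounded_lipschitz f := exists2 K : R, 0 <= K &
  (forall x, box x -> `|f x| <= K) /\
  (forall x y, box x -> box y -> `|f x - f y| <= K * `|x - y|).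

Lemma eq_bounded_lipschitz f g : f =1 g -> bounded_lipschitz f -> bounded_lipschitz g.
Proof. by move=> /funext ->. Qed.

Lemma bounded_lipschitz_cst c : bounded_lipschitz (fun=> c).
Proof.
exists `|c| => //; split=> // x y _ _.
by rewrite subrr normr0 mulr_ge0.
Qed.

Lemma bounded_lipschitz_coord i : bounded_lipschitz (fun x => x 0 i).
Proof.
exists (`|M| + 1); first by rewrite addr_ge0.
split=> [x xM|x y _ _].
  apply: (@le_trans _ _ `|x|); last by apply: le_trans xM _; rewrite -[leLHS]addr0 lerD // ler_norm.
  exact: norm_coord.
apply: (@le_trans _ _ `|x - y|); last by rewrite ler_peMl // lerDr.
have := norm_coord (x - y) i.
by rewrite !mxE.
Qed.

Lemma bounded_lipschitzD f g : bounded_lipschitz f -> bounded_lipschitz g ->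
  bounded_lipschitz (fun x => f x + g x).
Proof.
move=> [K K0 [fK fL]] [H H0 [gH gL]]; exists (K + H); first exact: addr_ge0.
split=> [x xM|x y xM yM].
  by apply: le_trans (ler_normD _ _) _; apply: lerD; [exact: fK|exact: gH].
rewrite opprD addrACA mulrDl; apply: le_trans (ler_normD _ _) _.
by apply: lerD; [exact: fL|exact: gL].
Qed.

Lemma bounded_lipschitzM f g : bounded_lipschitz f -> bounded_lipschitz g ->
  bounded_lipschitz (fun x => f x * g x).
Proof.
move=> [K K0 [fK fL]] [H H0 [gH gL]]; exists (2 * K * H); first by rewrite !mulr_ge0.
split=> [x xM|x y xM yM].
  rewrite normrM; apply: (@le_trans _ _ (K * H)); last by rewrite -mulrA ler_peMl ?mulr_ge0 // ler1n.
  by apply: ler_pM => //; [exact: fK|exact: gH].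
have -> : f x * g x - f y * g y = f x * (g x - g y) + g y * (f x - f y) by ring.
apply: le_trans (ler_normD _ _) _; rewrite !normrM.
have : `|f x| * `|g x - g y| <= K * (H * `|x - y|).
  by apply: ler_pM => //; [exact: fK|exact: gL].
have : `|g y| * `|f x - f y| <= H * (K * `|x - y|).
  by apply: ler_pM => //; [exact: gH|exact: fL].
lra.
Qed.

Lemma bounded_lipschitz_sum (I : Type) (l : seq I) (F : I -> 'rV[R]_n -> R) :
  (forall i, bounded_lipschitz (F i)) -> bounded_lipschitz (fun x => \sum_(i <- l) F i x).
Proof.
move=> FB; elim: l => [|i l IH].
  apply: eq_bounded_lipschitz (bounded_lipschitz_cst 0) => x.
  by rewrite big_nil.
apply: eq_bounded_lipschitz (bounded_lipschitzD (FB i) IH) => x.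
by rewrite big_cons.
Qed.

Lemma bounded_lipschitz_prod (I : Type) (l : seq I) (F : I -> 'rV[R]_n -> R) :
  (forall i, bounded_lipschitz (F i)) -> bounded_lipschitz (fun x => \prod_(i <- l) F i x).
Proof.
move=> FB; elim: l => [|i l IH].
  apply: eq_bounded_lipschitz (bounded_lipschitz_cst 1) => x.
  by rewrite big_nil.
apply: eq_bounded_lipschitz (bounded_lipschitzM (FB i) IH) => x.
by rewrite big_cons.
Qed.

Lemma bounded_lipschitz_zeval (P : mpoly n int) : bounded_lipschitz (fun x => zeval x P).
Proof.
apply: bounded_lipschitz_sum => u; apply: bounded_lipschitzM.
  exact: bounded_lipschitz_cst.
apply: bounded_lipschitz_prod => i; elim: (u i) => [|k IH].
  exact: bounded_lipschitz_cst.
apply: eq_bounded_lipschitz (bounded_lipschitzM (bounded_lipschitz_coord i) IH) => x.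
by rewrite exprS.
Qed.

Lemma zeval_lipschitz m (P : 'I_m -> mpoly n int) : exists2 L : R, 1 <= L &
  forall j x y, `|x| <= M -> `|y| <= M -> `|zeval x (P j) - zeval y (P j)| <= L * `|x - y|.
Proof.
have /choice [K KP] : forall j, exists K : R, 0 <= K /\ forall x y, `|x| <= M -> `|y| <= M ->
    `|zeval x (P j) - zeval y (P j)| <= K * `|x - y|.
  by move=> j; have [K K0 [_ h]] := bounded_lipschitz_zeval (P j); exists K.
exists (1 + \sum_j K j).
  by rewrite lerDl; apply: sumr_ge0 => j _; case: (KP j).
move=> j x y xM yM; have [K0 h] := KP j; apply: le_trans (h x y xM yM) _.
rewrite ler_wpM2r // (bigD1 j) //= addrCA lerDl addr_ge0 //.
by apply: sumr_ge0 => k _; case: (KP k).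
Qed.

End Lipschitz.

Lemma norm_lsubmx (R : realType) n m (v : 'rV[R]_(n + m)) : `|lsubmx v| <= `|v|.
Proof. by apply/rV_norm_le => // i; rewrite mxE; exact: norm_coord. Qed.

Lemma lsubmx_ratpoint (R : realType) n m (p : 'rV[int]_(n + m)) q :
  lsubmx (ratpoint R p q) = ratpoint R (lsubmx p) q.
Proof. by apply/rowP => i; rewrite !mxE. Qed.

(** Allows denominators below any threshold to be disregarded when approximants are counted. *)
Lemma finite_ratpoints (R : realType) k (v : 'rV[R]_k) (B : nat) (C : R) :
  finite_set [set r | exists (p : 'rV[int]_k) (q : nat),
    [/\ (0 < q <= B)%N, r = ratpoint R p q & `|v - r| <= C]].
Proof.
pose N := (Num.truncn (B%:R * (`|v| + `|C|))).+1.
pose F (t : 'I_B.+1 * {ffun 'I_k -> 'I_(N + N)}) : 'rV[R]_k :=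
  ratpoint R (\row_i ((t.2 i)%:Z - N%:Z)) t.1.
apply: (@sub_finite_set _ _ (F @` [set: _])); last exact: finite_image.
move=> _ [p [q [/andP [q0 qB] -> h]]].
have qR : 0 < q%:R :> R by rewrite ltr0n.
have pN i : `|(p 0 i)%:~R| < N%:R :> R.
  apply: le_lt_trans (truncnS_gt _).
  have -> : (p 0 i)%:~R = q%:R * (v 0 i - (v - ratpoint R p q) 0 i) :> R.
    by rewrite !mxE; field; lra.
  rewrite normrM (gtr0_norm qR); apply: ler_pM => //; first by rewrite ler_nat.
  apply: le_trans (ler_normB _ _) _; apply: lerD; first exact: norm_coord.
  by apply: le_trans (norm_coord _ _) _; apply: le_trans h _; exact: ler_norm.
have pN' i : (`|(p 0 i + N%:Z)%R| < N + N)%N /\ 0 <= p 0 i + N%:Z.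
  have := pN i; rewrite -intr_norm pmulrn ltr_int; lia.
exists (Ordinal (qB : (q < B.+1)%N), [ffun i => Ordinal (pN' i).1]) => //.
apply/rowP => i; rewrite !mxE /= ffunE /=; congr (_%:~R / _).
by have [_ h0] := pN' i; lia.
Qed.

Section Graph.
Variables (R : realType) (n m d : nat) (P : 'I_m -> mpoly n int).

(** In degree 0 the forms are constant: vanishing at 0, they would vanish everywhere. *)
Lemma degree_gt0 (n0 : (0 < n)%N) :
  (forall z : 'rV[algC]_n, (forall i, zeval z (homog_part d (P i)) = 0) <-> z = 0) ->
  (0 < d)%N.
Proof.
move=> h; rewrite lt0n; apply/negP => /eqP d0.
have e (z : 'rV[algC]_n) i : zeval z (homog_part d (P i)) = zeval 0 (homog_part d (P i)).
  rewrite d0 /homog_part /zeval !raddf_sum /=; apply: eq_bigr => u /eqP.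
  by move=> /eqP; rewrite mdeg_eq0 => /eqP ->; rewrite !mmapZ !mmapX !mmap11.
have : const_mx 1 = 0 :> 'rV[algC]_n.
  by apply/h => i; rewrite e; have [_ h0] := h 0; exact: h0.
move=> /rowP /(_ (Ordinal n0)); rewrite !mxE => /eqP; by rewrite oner_eq0.
Qed.

Lemma simult_approx_intrinsic (tau : R) : (0 < d)%N -> (forall j, (tdeg (P j) <= d)%N) ->
  d%:R < tau -> simult_approx tau (poly_graph P) = intrinsic_approx tau (poly_graph P).
Proof.
move=> d0 Pd dtau.
apply/seteqP; split=> v [vG vinf]; split=> //; last first.
  by apply: sub_infinite_set vinf; exact: subIsetl.
have [L L1 LP] := zeval_lipschitz (`|v| + 1) P.
have taud : 0 < tau - d%:R by rewrite subr_gt0.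
(* Beyond [Q] the error [(L + 1) * q ^ (d - tau)] is below 1: [L] accounts for the change of [P j],
   1 for that of the last coordinates, and [L + 2] makes the inequality strict. *)
have [Q QP] := @powR_ge_eventually R (tau - d%:R) (L + 2) taud.
move=> fin; apply: vinf.
apply: (@sub_finite_set _ _ ((approximants tau v `&` poly_graph P) `|`
  [set r | exists (p : 'rV[int]_(n + m)) (q : nat),
    [/\ (0 < q <= Q)%N, r = ratpoint R p q & `|v - r| <= 1]])); last first.
  by rewrite finite_setU; split=> //; exact: finite_ratpoints.
move=> r [p [q [q0 re h]]].
have qR : 0 < q%:R :> R by rewrite ltr0n.
have tau0 : 0 < tau by apply: le_lt_trans dtau; rewrite ler0n.
have h1 : `|v - r| <= 1.
  by apply: le_trans h _; rewrite -[leRHS](powRr0 q%:R) ler_powR ?ler1n // oppr_le0 ltW.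
have [qQ|Qq] := leqP q Q; first by right; exists p, q; rewrite q0 qQ.
left; split; first by exists p, q.
move=> j.
have rE : rsubmx r 0 j = (rsubmx p 0 j)%:~R / q%:R by rewrite re !mxE.
have rl : `|r| <= `|v| + 1.
  by rewrite -[r](subKr v); apply: le_trans (ler_normB _ _) _; rewrite lerD2l.
have dist : `|zeval (lsubmx r) (P j) - rsubmx r 0 j| <= (L + 1) * `|v - r|.
  have -> : zeval (lsubmx r) (P j) - rsubmx r 0 j =
      (rsubmx v 0 j - rsubmx r 0 j) - (zeval (lsubmx v) (P j) - zeval (lsubmx r) (P j)).
    by rewrite vG; ring.
  apply: le_trans (ler_normB _ _) _; rewrite addrC mulrDl mul1r; apply: lerD.
    apply: le_trans (LP j _ _ _ _) _.
    - by apply: le_trans (norm_lsubmx _) _; rewrite lerDl.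
    - exact: le_trans (norm_lsubmx _) rl.
    - by rewrite ler_wpM2l ?(le_trans ler01) // -linearB; exact: norm_lsubmx.
  by have := norm_coord (v - r) (rshift n j); rewrite !mxE.
pose z := cleared d (P j) (lsubmx p) q - rsubmx p 0 j * q%:Z ^+ d.-1.
have zE : z%:~R = (zeval (lsubmx r) (P j) - rsubmx r 0 j) * q%:R ^+ d.
  rewrite mulrBl re lsubmx_ratpoint zeval_ratpoint // -re rE /z rmorphB rmorphM rmorphXn /=.
  by rewrite -{4}(prednK d0) exprS mulrA divfK ?gt_eqF.
have z1 : `|z%:~R| < 1 :> R.
  rewrite zE normrM [X in _ * X]gtr0_norm ?exprn_gt0 //.
  have qpow : 0 < q%:R `^ (tau - d%:R) by rewrite powR_gt0.
  have : `|zeval (lsubmx r) (P j) - rsubmx r 0 j| <= (L + 1) * q%:R `^ (- tau).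
    by apply: le_trans dist _; rewrite ler_wpM2l // addr_ge0 // (le_trans ler01).
  move=> le1; apply: (@le_lt_trans _ _ ((L + 1) * q%:R `^ (- tau) * q%:R ^+ d)).
    by rewrite ler_wpM2r // exprn_ge0 // ltW.
  rewrite -mulrA -powR_mulrn ?(ltW qR) // -powRD; last by rewrite (gt_eqF qR) implybT.
  have -> : - tau + d%:R = - (tau - d%:R) by ring.
  rewrite powRN ltr_pdivrMr // mul1r.
  by apply: lt_le_trans (QP q (ltnW Qq)); rewrite ltrD2l ltr1n.
have z0 : z = 0 by move: z1; rewrite -intr_norm -[1]/(1%:~R) ltr_int; lia.
move: zE; rewrite z0 => /esym /eqP; rewrite mulf_eq0 expf_eq0 (gt_eqF qR) andbF orbF.
by rewrite subr_eq0 => /eqP.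
Qed.

End Graph.

(** * Hausdorff content *)

Section HausdorffTheory.
Context {R : realType} {T : normedModType R}.
Implicit Types (A U : set T) (s delta : R).
Local Open Scope ereal_scope.

Lemma diam_ge0 U : 0 <= diam U.
Proof. by apply: ereal_sup_ubound; left. Qed.

Lemma diam_pow_ge0 s U : 0 <= diam_pow s U.
Proof. by rewrite /diam_pow; case: ifP => // _; exact: poweR_ge0. Qed.

Lemma diam_le U (e : R) : (0 <= e)%R ->
  (forall x y, U x -> U y -> (`|x - y| <= e)%R) -> diam U <= e%:E.
Proof.
move=> e0 Ue; apply: ge_ereal_sup => _ [->|[x [y [Ux Uy ->]]]]; rewrite lee_fin //.
exact: Ue.
Qed.

Lemma dist_le_diam U (e : R) x y : diam U <= e%:E -> U x -> U y -> (`|x - y| <= e)%R.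
Proof.
move=> Ue Ux Uy; rewrite -lee_fin; apply: le_trans Ue.
by apply: ereal_sup_ubound; right; exists x, y.
Qed.

Lemma diam_pow_le s U (e : R) : (0 <= s)%R -> (0 <= e)%R -> diam U <= e%:E ->
  diam_pow s U <= (e `^ s)%:E.
Proof.
move=> s0 e0 Ue; rewrite /diam_pow; case: ifP => _; first by rewrite lee_fin powR_ge0.
rewrite -poweR_EFin; apply: gt0_ler_poweR => //; rewrite in_itv /= ?diam_ge0 ?leey //.
by rewrite lee_fin e0.
Qed.

Lemma hausdorff_content_ge0 s delta A : 0 <= hausdorff_content s delta A.
Proof.
apply: le_ereal_inf_tmp => _ [U [_ _ ->]].
by apply: nneseries_ge0 => i _ _; exact: diam_pow_ge0.
Qed.

Lemma hausdorff_measure_eq0 s A :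
  (forall delta e : R, (0 < delta)%R -> (0 < e)%R -> hausdorff_content s delta A <= e%:E) ->
  hausdorff_measure s A = 0.
Proof.
move=> h; apply/eqP; rewrite eq_le; apply/andP; split.
  apply: ge_ereal_sup => _ [delta /= delta0 <-].
  by apply/lee_addgt0Pr => e e0; rewrite add0e; exact: h.
apply: le_trans (hausdorff_content_ge0 s 1%R A) _.
by apply: ereal_sup_ubound; exists 1%R => //=; exact: ltr01.
Qed.

Lemma hausdorff_measure0_cover s A (e : R) : hausdorff_measure s A = 0 -> (0 < e)%R ->
  exists U : (set T)^nat, [/\ A `<=` \bigcup_i U i, forall i, diam (U i) <= 1 &
    forall N, \sum_(0 <= i < N) diam_pow s (U i) <= e%:E].
Proof.
move=> mA e0.
have : hausdorff_content s 1%R A < e%:E.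
  apply: (@le_lt_trans _ _ 0); last by rewrite lte_fin.
  rewrite -mA; apply: ereal_sup_ubound; exists 1%R => //=; exact: ltr01.
move=> /ereal_inf_lt [_ [U [AU U1 ->]] h]; exists U; split=> // N.
apply: le_trans (ltW h); apply: nneseries_lim_ge => i _ _; exact: diam_pow_ge0.
Qed.

Lemma sum_uniq_sub (I : eqType) (g : I -> R) (l l' : seq I) : (forall i, (0 <= g i)%R) ->
  uniq l -> {subset l <= l'} -> (\sum_(i <- l) g i <= \sum_(i <- l') g i)%R.
Proof.
move=> g0; elim: l l' => [|x l IH] l'.
  by move=> _ _; rewrite big_nil; apply: sumr_ge0.
move=> /= /andP [xl ul] sub; have xl' : x \in l' by apply: sub; rewrite mem_head.
rewrite big_cons (perm_big _ (perm_to_rem xl')) big_cons lerD2l; apply: IH => // y yl.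
have : y \in l' by apply: sub; rewrite inE yl orbT.
rewrite (perm_mem (perm_to_rem xl')) inE => /orP [/eqP yx|//].
by rewrite yx (negPf xl) in yl.
Qed.

(** For covers made of one finite family per denominator. The pairs are enumerated by [pickle];
    codes of no pair give the empty set, which costs 0. *)
Lemma hausdorff_content_le A s delta (e : R) (K : nat -> finType)
    (V : forall k, K k -> set T) (g : nat -> R) : (0 <= delta)%R ->
  A `<=` [set x | exists k f, V k f x] ->
  (forall k f, diam (V k f) <= delta%:E) ->
  (forall k f, diam_pow s (V k f) <= (g k)%:E) ->
  (forall B, (\sum_(k < B) #|K k|%:R * g k <= e)%R) ->
  (forall k, (0 <= g k)%R) ->
  hausdorff_content s delta A <= e%:E.
Proof.
move=> delta0 AV dV gV ge g0.
pose I := {k : nat & K k}.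
pose W (i : nat) := oapp (fun t : I => V (tag t) (tagged t)) set0 (pickle_inv i).
have d0 : diam (set0 : set T) <= 0 by apply: diam_le.
apply: (@le_trans _ _ (\sum_(0 <= i <oo) diam_pow s (W i))).
  apply: ereal_inf_lbound; exists W; split=> //.
  - move=> x /AV [k [f Vx]]; exists (pickle (Tagged K f : I)) => //.
    by rewrite /W pickleK_inv.
  - move=> i; rewrite /W; case: pickle_inv => [t|] /=; first exact: dV.
    by apply: le_trans d0 _; rewrite lee_fin.
apply: lime_le.
  by apply: is_cvg_nneseries => i _ _; exact: diam_pow_ge0.
apply: nearW => N.
apply: (@le_trans _ _ (\sum_(0 <= i < N) (oapp (fun t : I => g (tag t)) 0%R (pickle_inv i))%:E)).
  apply: lee_sum => i _; rewrite /W; case: pickle_inv => [t|] /=; first exact: gV.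
  by rewrite /diam_pow eqxx.
rewrite sumEFin lee_fin -big_pmap.
set l := pmap _ _.
have ul : uniq l by rewrite /l; apply: (pmap_uniq (@pickle_invK I)); exact: iota_uniq.
pose B := (\max_(t <- l) (tag t)).+1.
apply: le_trans (ge B).
pose l' := [seq Tagged K f | k <- index_iota 0 B, f <- enum (K k)].
apply: (@le_trans _ _ (\sum_(t <- l') g (tag t))%R).
  apply: sum_uniq_sub => // -[k f] tl.
  apply/allpairsPdep; exists k, f; split=> //; last by rewrite mem_enum.
  rewrite mem_index_iota /= ltnS.
  exact: (@leq_bigmax_seq _ l xpredT (fun t : I => tag t) _ tl isT).
rewrite /l' big_allpairs_dep big_mkord le_eqVlt; apply/orP; left; apply/eqP.
by apply: eq_bigr => k _; rewrite big_enum /= sumr_const mulr_natl.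
Qed.

End HausdorffTheory.

(** A substitute for comparison with an integral: [1 + x <= expR x] and [ln (1 + x) <= x], applied
    to the ratio of [k] and [k.+1]. *)
Lemma powR_telescope (R : realType) (t : R) (k : nat) : 0 < t -> (0 < k)%N ->
  t * k.+1%:R `^ (- 1 - t) <= k%:R `^ (- t) - k.+1%:R `^ (- t).
Proof.
move=> t0 k0.
have kR : 0 < k%:R :> R by rewrite ltr0n.
have k1R : 0 < k.+1%:R :> R by rewrite ltr0n.
have e1 : k%:R `^ (- t) = k.+1%:R `^ (- t) * expR (t * - ln (k%:R / k.+1%:R)) :> R.
  rewrite /powR !gt_eqF // -expRD ln_div ?posrE //; congr expR; ring.
have e2 : k.+1%:R^-1 <= - ln (k%:R / k.+1%:R) :> R.
  rewrite lerNr; have -> : k%:R / k.+1%:R = 1 + - k.+1%:R^-1 :> R.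
    by rewrite -natr1; field; lra.
  by apply: le_ln1Dx; rewrite ltrN2 invf_lt1 // ltr1n.
have -> : k.+1%:R `^ (- 1 - t) = k.+1%:R^-1 * k.+1%:R `^ (- t) :> R.
  by rewrite powRD ?(gt_eqF k1R) ?implybT // powR_inv1 // ltW.
rewrite e1.
have h : 1 + t * k.+1%:R^-1 <= expR (t * - ln (k%:R / k.+1%:R)).
  by apply: le_trans (expR_ge1Dx _); rewrite lerD2l ler_pM2l.
have p0 : 0 < k.+1%:R `^ (- t) :> R by exact: powR_gt0.
have := ler_wpM2l (ltW p0) h.
set E := expR _; set p := k.+1%:R `^ (- t); set i := k.+1%:R^-1.
move: E p i => E p i; lra.
Qed.

Lemma powR_tail (R : realType) (t e : R) : 0 < t -> 0 < e -> exists Q : nat, (0 < Q)%N /\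
  forall B, \sum_(k < B | (Q <= k)%N) k.+1%:R `^ (- 1 - t) <= e.
Proof.
move=> t0 e0.
have [Q0 Q0P] := @powR_ge_eventually R t (t * e)^-1 t0.
pose Q := Q0.+1; exists Q; split=> // B.
have QR : 0 < Q%:R :> R by rewrite ltr0n.
have Qe : Q%:R `^ (- t) <= t * e.
  rewrite powRN -[leRHS]invrK lef_pV2 ?posrE ?powR_gt0 ?invr_gt0 ?mulr_gt0 //.
  by apply: Q0P; exact: leqnSn.
suff : t * \sum_(k < B | (Q <= k)%N) k.+1%:R `^ (- 1 - t) <= t * e by rewrite ler_pM2l.
have [BQ|QB] := leqP B Q.
  rewrite big1 ?mulr0 ?mulr_ge0 // ?ltW // => k Qk.
  by have := leq_trans BQ Qk; rewrite leqNgt ltn_ord.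
suff : t * \sum_(k < B | (Q <= k)%N) k.+1%:R `^ (- 1 - t) <= Q%:R `^ (- t) - B%:R `^ (- t).
  by have := powR_ge0 B%:R (- t); lra.
elim: B QB => // B IH; rewrite ltnS => QB.
rewrite big_mkcond big_ord_recr -big_mkcond /= QB.
have := @powR_telescope R t B t0 (leq_trans (ltn0Sn _) QB).
move: QB; rewrite leq_eqVlt => /orP [/eqP <-|/IH]; last lra.
by rewrite big1 ?add0r // => k; rewrite leqNgt ltn_ord.
Qed.

(** * Dimension of the intrinsic approximation set *)

Section GraphPoints.
Variables (R : realType) (n m : nat) (P : 'I_m -> mpoly n int).

Definition graph_point (x : 'rV[R]_n) : 'rV[R]_(n + m) := row_mx x (\row_j zeval x (P j)).

Lemma graph_point_in x : poly_graph P (graph_point x).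
Proof. by move=> j; rewrite row_mxKr row_mxKl mxE. Qed.

Lemma graph_pointE v : poly_graph P v -> v = graph_point (lsubmx v).
Proof.
move=> vG; rewrite -[LHS]hsubmxK; congr row_mx; apply/rowP => j.
by rewrite [RHS]mxE vG.
Qed.

Lemma norm_row_mx_le (x : 'rV[R]_n) (y : 'rV[R]_m) (e : R) :
  `|x| <= e -> (forall j, `|y 0 j| <= e) -> `|row_mx x y| <= e.
Proof.
move=> xe ye; have e0 : 0 <= e by apply: le_trans xe.
apply/rV_norm_le => // i; rewrite mxE; case: splitP => j _ //.
exact: le_trans (norm_coord _ _) xe.
Qed.

Lemma graph_point_ratpoint d (a : 'rV[int]_n) q : (0 < d)%N -> (0 < q)%N ->
  (forall j, (tdeg (P j) <= d)%N) ->
  exists p, graph_point (ratpoint R a q) = ratpoint R p (q ^ d).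
Proof.
move=> d0 q0 Pd; have qR : 0 < q%:R :> R by rewrite ltr0n.
exists (row_mx (\row_i (a 0 i * q%:Z ^+ d.-1)) (\row_j cleared d (P j) a q)).
have -> : ratpoint R (row_mx (\row_i (a 0 i * q%:Z ^+ d.-1)) (\row_j cleared d (P j) a q)) (q ^ d)
    = row_mx (ratpoint R (\row_i (a 0 i * q%:Z ^+ d.-1)) (q ^ d))
             (ratpoint R (\row_j cleared d (P j) a q) (q ^ d)).
  by apply/rowP => i; rewrite !mxE; case: splitP => j _; rewrite !mxE.
congr row_mx; apply/rowP => i; rewrite !mxE natrX.
  rewrite rmorphM rmorphXn /= -[in RHS](prednK d0) exprSr /=.
  have : q%:R ^+ d.-1 != 0 :> R by rewrite expf_neq0 // gt_eqF.
  by move: (_ ^+ _) => w w0; field; rewrite w0 gt_eqF.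
by rewrite -(@zeval_ratpoint R) // mulfK // expf_neq0 // gt_eqF.
Qed.

(** The last coordinates are integers over [q], so [q * P j (a / b)] is an integer, which is the
    divisibility that bounds [b ^ d]. *)
Lemma poly_graph_ratpoint d D (p : 'rV[int]_(n + m)) q : (0 < q)%N ->
  (forall j, (tdeg (P j) <= d)%N) ->
  (forall (a : 'rV[int]_n) (b q : nat),
    (0 < b)%N -> (0 < q)%N -> \big[gcdn/b]_(i < n) `|a 0%R i|%N = 1%N ->
    (forall j, (b%:Z ^+ d %| q%:Z * cleared d (P j) a b)%Z) -> (b ^ d <= D * q)%N) ->
  poly_graph P (ratpoint R p q) ->
  exists (a : 'rV[int]_n) (b : nat), [/\ (0 < b)%N, (b ^ d <= D * q)%N &
    ratpoint R p q = graph_point (ratpoint R a b)].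
Proof.
move=> q0 Pd DP pG; have qR : 0 < q%:R :> R by rewrite ltr0n.
have [a [b [b0 ab1 e]]] := @coprime_rep n R (lsubmx p) q q0.
have bR : 0 < b%:R :> R by rewrite ltr0n.
exists a, b; split=> //; last by rewrite [LHS]graph_pointE // lsubmx_ratpoint e.
apply: (DP a b q) => // j.
suff -> : q%:Z * cleared d (P j) a b = b%:Z ^+ d * rsubmx p 0 j by apply: dvdz_mulr.
apply: (@intr_inj R); rewrite !rmorphM rmorphXn /= -(@zeval_ratpoint R) // -e -lsubmx_ratpoint.
rewrite -pG; have -> : rsubmx (ratpoint R p q) 0 j = (rsubmx p 0 j)%:~R / q%:R by rewrite !mxE.
by field; lra.
Qed.

End GraphPoints.

Section Dimension.
Variables (R : realType) (n m d : nat) (P : 'I_m -> mpoly n int).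

Lemma intrinsic_approx_lower (tau s : R) : (0 < n)%N -> (0 < d)%N ->
  (forall j, (tdeg (P j) <= d)%N) -> n.+1%:R / (n * d)%:R < tau -> 0 <= s ->
  hausdorff_measure s (intrinsic_approx tau (poly_graph P)) = 0%E ->
  n.+1%:R / (d%:R * tau) <= s.
Proof.
move=> n0 d0 Pd htau s0 m0; rewrite leNgt; apply/negP => slt.
have nR : 0 < n%:R :> R by rewrite ltr0n.
have dR : 0 < d%:R :> R by rewrite ltr0n.
have ndtau : n.+1%:R < n%:R * (d%:R * tau).
  by move: htau; rewrite ltr_pdivrMr ?ltr0n ?muln_gt0 ?n0 // natrM; lra.
set sigma := d%:R * tau in slt ndtau.
have sigma0 : 0 < sigma.
  by rewrite -(pmulr_rgt0 _ nR); apply: lt_trans ndtau; rewrite ltr0n.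
have tau0 : 0 < tau by move: sigma0; rewrite pmulr_rgt0.
have s0n : n.+1%:R / sigma < n%:R by rewrite ltr_pdivrMr.
(* [s] may be 0, while the nested cubes need a positive exponent; passing to [t] does not increase
   the sum, as the diameters are at most 1. *)
pose t := (s + n.+1%:R / sigma) / 2.
have st : s < t by rewrite /t; lra.
have ts : t < n.+1%:R / sigma by rewrite /t; lra.
have t0 : 0 < t by lra.
have sigma_t : sigma * t < n.+1%:R by move: ts; rewrite ltr_pdivlMr // mulrC.
pose e := 44^-1 `^ t / 2.
have e0 : 0 < e by rewrite divr_gt0 // powR_gt0.
have [U [AU U1 UN]] := hausdorff_measure0_cover m0 e0.
pose del i := fine (diam (U i)).
have delE i : diam (U i) = (del i)%:E.
  rewrite fineK // ge0_fin_numE; last exact: diam_ge0.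
  by apply: le_lt_trans (U1 i) _; rewrite ltry.
have del0 i : 0 <= del i by rewrite -lee_fin -delE diam_ge0.
have del1 i : del i <= 1 by rewrite -lee_fin -delE U1.
have del_pow i : ((del i `^ t)%:E <= diam_pow s (U i))%E.
  rewrite /diam_pow; case: eqP => [U0|_].
    have -> : del i = 0.
      apply/eqP; rewrite eq_le del0 andbT -lee_fin -delE U0.
      by apply: diam_le.
    by rewrite powR0 // gt_eqF.
  rewrite delE poweR_EFin lee_fin.
  have [->|di0] := eqVneq (del i) 0; first by rewrite powR0 ?gt_eqF ?powR_ge0.
  by apply: ger_powR; [rewrite lt0r di0 del0 del1|exact: ltW].
(* The avoidance argument needs positive sizes, so zero diameters are enlarged; the total extra
   weight is at most [e], the other half of the allowance. *)
pose D i := (del i `^ t + e * 2^-1 ^+ i.+1) `^ t^-1.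
have base0 i : 0 < del i `^ t + e * 2^-1 ^+ i.+1.
  by apply: ltr_wpDl; [exact: powR_ge0|rewrite mulr_gt0 // exprn_gt0 // invr_gt0].
have Dt i : D i `^ t = del i `^ t + e * 2^-1 ^+ i.+1.
  by rewrite /D -powRrM mulVf ?gt_eqF // powRr1 // ltW.
have D0 i : 0 < D i by exact: powR_gt0.
have delD i : del i <= D i.
  have -> : del i = (del i `^ t) `^ t^-1 by rewrite -powRrM mulfV ?gt_eqF // powRr1.
  apply: ge0_ler_powR; rewrite ?nnegrE ?invr_ge0 ?powR_ge0 ?(ltW t0) ?(ltW (base0 i)) //.
  by rewrite lerDl mulr_ge0 ?(ltW e0) // exprn_ge0 // invr_ge0.
have sumD N : \sum_(i < N) D i `^ t <= 44^-1 `^ t.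
  under eq_bigr do rewrite Dt.
  rewrite big_split /=.
  have -> : 44^-1 `^ t = e + e :> R by rewrite /e; lra.
  apply: lerD.
    rewrite -lee_fin; apply: le_trans (UN N); rewrite big_mkord -sumEFin.
    by apply: lee_sum => i _; exact: del_pow.
  rewrite -mulr_sumr ler_piMr ?(ltW e0) //.
  suff -> : \sum_(i < N) 2^-1 ^+ i.+1 = 1 - 2^-1 ^+ N :> R.
    by rewrite gerBl exprn_ge0 // invr_ge0.
  elim: N => [|N IH]; first by rewrite big_ord0 expr0 subrr.
  by rewrite big_ord_recr /= IH exprS; lra.
pose V i := [set x : 'rV[R]_n | U i (graph_point P x)].
have VD i x y : V i x -> V i y -> `|x - y| <= D i.
  move=> Vx Vy; apply: le_trans (delD i).
  have UD : (diam (U i) <= (del i)%:E)%E by rewrite delE.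
  apply: le_trans (dist_le_diam UD Vx Vy); have := norm_lsubmx (graph_point P x - graph_point P y).
  by rewrite linearB /= !row_mxKl.
(* Radius 2 contains the point [x] of the unit cube and its approximants at distance at most 1; the
   factor [1 / L] in their distance offsets the Lipschitz constant. *)
have [L L1 LP] := zeval_lipschitz (2 : R) P.
have [x [x01 xV xinf]] := @avoiding_point R n t V D sigma L n0 t0
  (lt_trans ts s0n) D0 VD L1 (ltW ndtau) sigma_t sumD.
have x1 : `|x| <= 1.
  by apply/rV_norm_le => // i; have := x01 i; rewrite ler_norml; lra.
suff : intrinsic_approx tau (poly_graph P) (graph_point P x).
  by move=> /AU [i _ Ui]; exact: (xV i).
split; first exact: graph_point_in.
move=> fin; apply: xinf.
apply: (@sub_finite_set _ _ (lsubmx @` (approximants tau (graph_point P x) `&` poly_graph P))); last first.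
  exact: finite_image.
move=> _ [a [q [q0 -> hq]]].
exists (graph_point P (ratpoint R a q)); last by rewrite row_mxKl.
split; last exact: graph_point_in.
have [p pE] := graph_point_ratpoint R a d0 q0 Pd.
exists p, (q ^ d)%N; split=> //; first by rewrite expn_gt0 q0.
have L0 : 0 < L by lra.
have qs0 : 0 <= q%:R `^ (- sigma) by exact: powR_ge0.
have qs1 : q%:R `^ (- sigma) <= 1 :> R.
  by rewrite -[leRHS](powRr0 q%:R) ler_powR ?ler1n // oppr_le0 ltW.
have qsL : q%:R `^ (- sigma) / L <= q%:R `^ (- sigma).
  by rewrite ler_pdivrMr // ler_peMr.
have -> : (q ^ d)%N%:R `^ (- tau) = q%:R `^ (- sigma) :> R.
  by rewrite natrX -powR_mulrn // -powRrM mulrN.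
rewrite /graph_point opp_row_mx add_row_mx.
apply: norm_row_mx_le; first exact: le_trans hq qsL.
move=> j; rewrite !mxE; apply: le_trans (LP j _ _ _ _) _.
- by lra.
- rewrite -[ratpoint R a q](subKr x); apply: le_trans (ler_normB _ _) _; lra.
- by move: hq; rewrite ler_pdivlMr // mulrC.
Qed.

End Dimension.

Lemma absz_shift (x : int) (N : nat) : (`|x| <= N)%N ->
  (`|(x + N%:Z)%R| < (N + N).+1)%N /\ 0 <= x + N%:Z.
Proof. lia. Qed.

Lemma intrinsic_approx_upper (R : realType) (n m d D : nat) (P : 'I_m -> mpoly n int)
    (tau s : R) : (0 < n)%N -> (0 < d)%N -> (0 < D)%N ->
  (forall j, (tdeg (P j) <= d)%N) ->
  (forall (a : 'rV[int]_n) (b q : nat),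
    (0 < b)%N -> (0 < q)%N -> \big[gcdn/b]_(i < n) `|a 0%R i|%N = 1%N ->
    (forall j, (b%:Z ^+ d %| q%:Z * cleared d (P j) a b)%Z) -> (b ^ d <= D * q)%N) ->
  0 < tau -> n.+1%:R / (d%:R * tau) < s ->
  hausdorff_measure s (intrinsic_approx tau (poly_graph P)) = 0%E.
Proof.
move=> n0 d0 D0 Pd DP tau0 slt.
have nR : 0 < n%:R :> R by rewrite ltr0n.
have dR : 0 < d%:R :> R by rewrite ltr0n.
have DR : 0 < D%:R :> R by rewrite ltr0n.
set sigma := d%:R * tau in slt.
have sigma0 : 0 < sigma by exact: mulr_gt0.
have s0 : 0 < s by apply: lt_trans slt; rewrite divr_gt0 // ltr0n.
(* About [b ^ (n * (1 + eta)) = b ^ (n + theta)] centres over [b], each costing about [b ^ (- sigma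
   * s) = b ^ (- n - 1 - 2 * theta)], give the convergent series of [b ^ (- 1 - theta)]. *)
pose theta := (sigma * s - n.+1%:R) / 2.
have theta0 : 0 < theta.
  by move: slt; rewrite ltr_pdivrMr // /theta => h; rewrite divr_gt0 // subr_gt0 mulrC.
pose eta := theta / n%:R.
have eta0 : 0 < eta by exact: divr_gt0.
(* From [b ^ d <= D * q] follows [q ^ (- tau) <= D ^ tau * b ^ (- d * tau)], which is [rho b]. *)
pose c := D%:R `^ tau.
have c0 : 0 < c by exact: powR_gt0.
pose rho (b : nat) := c * b%:R `^ (- sigma).
have rho0 b : (0 < b)%N -> 0 < rho b by move=> b0; rewrite mulr_gt0 // powR_gt0 // ltr0n.
apply: hausdorff_measure_eq0 => delta e delta0 e0.
pose C := 3 ^+ n * (2 * c) `^ s.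
have C0 : 0 < C by rewrite mulr_gt0 ?exprn_gt0 // powR_gt0 // mulr_gt0.
have eC0 : 0 < e / C by exact: divr_gt0.
have [Q1 [_ Q1P]] := powR_tail theta0 eC0.
have [Q2 Q2P] := powR_ge_eventually (2 * c / delta) sigma0.
pose Q := maxn Q1 Q2.
have rho_delta k : (Q <= k)%N -> 2 * rho k.+1 <= delta.
  move=> Qk; have := Q2P k.+1 (leq_trans (leq_trans (leq_maxr _ _) Qk) (leqnSn k)).
  rewrite /rho powRN mulrA ler_pdivrMr ?powR_gt0 ?ltr0n //.
  by rewrite ler_pdivrMr // [delta * _]mulrC.
(* Letting the numerators grow slightly faster than the denominator [k.+1] covers the whole
   unbounded graph at once. *)
pose N (k : nat) := Num.truncn (k.+1%:R `^ (1 + eta) : R).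
pose K (k : nat) : finType := {ffun 'I_n -> 'I_(N k + N k).+1}.
pose a k (f : K k) : 'rV[int]_n := \row_i ((f i)%:Z - (N k)%:Z).
pose V k (f : K k) : set 'rV[R]_(n + m) :=
  [set v | (Q <= k)%N /\ `|v - graph_point P (ratpoint R (a k f) k.+1)| <= rho k.+1].
pose g (k : nat) := if (Q <= k)%N then (2 * rho k.+1) `^ s else 0.
have Vdiam k f : (diam (V k f) <= (2 * rho k.+1)%:E)%E.
  apply: diam_le => [|x y [_ hx] [_ hy]]; first by rewrite mulr_ge0 // ltW // rho0.
  set z := graph_point _ _ in hx hy.
  have -> : x - y = (x - z) - (y - z) by rewrite opprB addrA subrK.
  by apply: le_trans (ler_normB _ _) _; lra.
have V0 k f : (Q <= k)%N = false -> V k f = set0.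
  by move=> Qk; apply/seteqP; split => // x []; rewrite Qk.
apply: (hausdorff_content_le (K := K) (V := V) (g := g)) => //; first exact: ltW.
- move=> v [vG vinf]; apply: contrapT => noV; apply: vinf.
  (* From [B0] on, the numerators, at most [b * (|v| + 1)] in absolute value, are within the range
     [b ^ (1 + eta)]. *)
  have [B0 B0P] := powR_ge_eventually (`|v| + 1) eta0.
  pose B1 := maxn B0 Q.+1.
  apply: (@sub_finite_set _ _ (graph_point P @` [set y | exists (a : 'rV[int]_n) (b : nat),
    [/\ (0 < b <= B1)%N, y = ratpoint R a b & `|lsubmx v - y| <= 1]])); last first.
    by apply: finite_image; exact: finite_ratpoints.
  move=> _ [[p [q [q0 -> hq]]] rG].
  have qR : 0 < q%:R :> R by rewrite ltr0n.
  have h1 : `|v - ratpoint R p q| <= 1.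
    by apply: le_trans hq _; rewrite -[leRHS](powRr0 q%:R) ler_powR ?ler1n // oppr_le0 ltW.
  have [a' [b [b0 bq rE]]] := poly_graph_ratpoint q0 Pd DP rG.
  have bR : 0 < b%:R :> R by rewrite ltr0n.
  have [bB|Bb] := leqP b B1.
    exists (ratpoint R a' b); last by rewrite rE.
    exists a', b; rewrite b0 bB; split=> //.
    have := le_trans (norm_lsubmx (v - ratpoint R p q)) h1.
    by rewrite linearB /= rE row_mxKl.
  exfalso; apply: noV.
  have bS : b = b.-1.+1 by rewrite prednK.
  have Qb : (Q <= b.-1)%N by rewrite -ltnS -bS; apply: leq_trans (ltnW Bb); exact: leq_maxr.
  have coordN i : (`|a' 0%R i| <= N b.-1)%N.
    rewrite /N -bS truncn_ge_nat ?powR_ge0 // powRD ?(gt_eqF bR) ?implybT // powRr1 ?(ltW bR) //.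
    rewrite natr_absz intr_norm.
    have -> : (a' 0 i)%:~R = b%:R * lsubmx (ratpoint R p q) 0 i :> R.
      by rewrite rE row_mxKl mxE mulrC divfK ?gt_eqF.
    rewrite normrM gtr0_norm // ler_pM2l //.
    apply: le_trans (norm_coord _ _) _; apply: le_trans (norm_lsubmx _) _.
    apply: le_trans (B0P b (leq_trans (leq_maxl _ _) (ltnW Bb))).
    rewrite -[ratpoint R p q](subKr v); apply: le_trans (ler_normB _ _) _; lra.
  have fP i : (`|(a' 0 i + (N b.-1)%:Z)%R| < (N b.-1 + N b.-1).+1)%N /\ 0 <= a' 0 i + (N b.-1)%:Z.
    exact: absz_shift.
  exists b.-1, [ffun i => Ordinal (fP i).1]; split=> //.
  have -> : a b.-1 [ffun i => Ordinal (fP i).1] = a'.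
    by apply/rowP => i; rewrite mxE ffunE /= gez0_abs ?addrK //; case: (fP i).
  rewrite -bS -rE; apply: le_trans hq _.
  rewrite /rho !powRN ler_pdivlMr ?powR_gt0 // mulrC ler_pdivrMr ?powR_gt0 //.
  rewrite /c -powRM ?(ltW DR) ?(ltW qR) // /sigma powRrM powR_mulrn ?(ltW bR) //.
  by apply: ge0_ler_powR; rewrite ?nnegrE ?exprn_ge0 ?mulr_ge0 ?(ltW tau0) ?(ltW DR) ?(ltW qR) ?(ltW bR) // -natrX -natrM ler_nat.
- move=> k f; case Qk : (Q <= k)%N.
    by apply: le_trans (Vdiam k f) _; rewrite lee_fin rho_delta.
  by rewrite V0 //; apply: diam_le => //; exact: ltW.
- move=> k f; rewrite /g; case Qk : (Q <= k)%N.
    by apply: diam_pow_le => //; [exact: ltW|rewrite mulr_ge0 // ltW // rho0].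
  by rewrite V0 // /diam_pow eqxx.
- move=> B; apply: (@le_trans _ _ (\sum_(k < B | (Q1 <= k)%N) C * k.+1%:R `^ (- 1 - theta))).
    rewrite [leRHS]big_mkcond; apply: ler_sum => k _; rewrite /g.
    case: ifP => Qk; last by rewrite mulr0; case: ifP => // _; rewrite mulr_ge0 ?powR_ge0 // ltW.
    rewrite (leq_trans (leq_maxl _ _) Qk).
    have kR : 0 < k.+1%:R :> R by rewrite ltr0n.
    rewrite card_ffun !card_ord natrX.
    have -> : (2 * rho k.+1) `^ s = (2 * c) `^ s * k.+1%:R `^ (- sigma * s).
      by rewrite /rho mulrA powRM ?powR_ge0 -?powRrM // mulr_ge0 // ltW.
    have -> : - 1 - theta = (1 + eta) * n%:R + (- sigma * s).
      by rewrite /eta mulrDl divfK ?gt_eqF // /theta -natr1; field.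
    rewrite powRD ?(gt_eqF kR) ?implybT // powRrM powR_mulrn ?powR_ge0 //.
    have pk : 1 <= k.+1%:R `^ (1 + eta) :> R.
      by rewrite -[leLHS](powRr0 k.+1%:R) ler_powR ?ler1n // addr_ge0 // ltW.
    have hN : (N k + N k).+1%:R <= 3 * k.+1%:R `^ (1 + eta) :> R.
      have : (N k)%:R <= k.+1%:R `^ (1 + eta) :> R by rewrite truncn_le powR_ge0.
      by rewrite -[(N k + N k).+1]addn1 !natrD; lra.
    rewrite mulrACA -exprMn mulrC [leRHS]mulrC; apply: ler_wpM2l.
      by rewrite mulr_ge0 ?powR_ge0.
    by apply: lerXn2r; rewrite ?nnegrE // mulr_ge0 // ltW // powR_gt0.
  by rewrite -mulr_sumr mulrC -ler_pdivlMr //; exact: Q1P.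
- by move=> k; rewrite /g; case: ifP => // _; exact: powR_ge0.
Qed.

Theorem corollary5 (R : realType) (n m d : nat) (hn : (0 < n)%N) (hm : (0 < m)%N)
    (P : 'I_m -> mpoly n int)
    (hd : d = (\max_(j < m) tdeg (P j))%N)
    (hzero : forall z : 'rV[algC]_n,
       (forall i : 'I_m, zeval z (homog_part d (P i)) = 0) <-> z = 0) :
  (forall tau : R, n.+1%:R / (n * d)%:R < tau ->
     hausdorff_dim (intrinsic_approx tau (poly_graph P)) =
       ((1 + n)%:R / (d%:R * tau))%:E) /\
  (forall tau : R, d%:R < tau ->
     simult_approx tau (poly_graph P) = intrinsic_approx tau (poly_graph P)).
Proof.
have d0 := degree_gt0 hn hzero.
have Pd j : (tdeg (P j) <= d)%N by rewrite hd; exact: leq_bigmax.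
split; last by move=> tau; exact: simult_approx_intrinsic.
move=> tau htau.
have tau0 : 0 < tau.
  by apply: le_lt_trans htau; rewrite divr_ge0 ?ler0n.
have [D D0 DP] := denominator_bound Pd (fun z => (hzero z).1).
have dR : 0 < d%:R :> R by rewrite ltr0n.
apply/eqP; rewrite eq_le; apply/andP; split; last first.
  apply: le_ereal_inf_tmp => _ [s [s0 ms] <-]; rewrite lee_fin.
  exact: intrinsic_approx_lower ms.
apply/lee_addgt0Pr => e e0; apply: ereal_inf_lbound.
exists ((1 + n)%:R / (d%:R * tau) + e); last by rewrite EFinD.
split; first by rewrite addr_ge0 ?divr_ge0 ?mulr_ge0 ?(ltW tau0) ?(ltW e0) ?(ltW dR).
by apply: intrinsic_approx_upper DP _ _ => //; rewrite add1n ltrDl.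
Qed.
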